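(* Let $p\ge 1$ be an integer and let $\mathbf{x}_0=(a_1,\dots,a_{p-1};b_0,\dots,b_{p-1})$ be a vector of real numbers. Put $$U_{2p}(\mathbf{a},\mathbf{b})=\int_0^\infty \frac{b_0z^{2p-2}+b_1z^{2p-4}+\cdots+b_{p-1}}{z^{2p}+a_1z^{2p-2}+\cdots+a_{p-1}z^2+1}\,dz .$$ Define the sequence $(\mathbf{x}_n)_{n\ge 0}$ by $\mathbf{x}_{n+1}=\mathbf{x}_n^{+}$, where $\mathbf{x}\mapsto\mathbf{x}^+$ is the rational Landen transformation defined in the context. If the integral $U_{2p}(\mathbf{a},\mathbf{b})$ converges, then $$\mathbf{x}_n\longrightarrow\left(\binom p1,\binom p2,\dots,\binom p{p-1};\ \binom{p-1}{0}L,\ \binom{p-1}{1}L,\ \dots,\ \binom{p-1}{p-1}L\right)\quad (n\to\infty),\qquad L=\frac{2}{\pi}\,U_{2p}(\mathbf{a},\mathbf{b}).$$ Moreover, the convergence of the iteration $(\mathbf{x}_n)$ (to a limit of this form) is equivalent to the convergence of the initial integral $U_{2p}(\mathbf{a},\mathbf{b})$.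
   Context: Definition of $\mathbf{x}^+$. Given $\mathbf{x}=(a_1,\dots,a_{p-1};b_0,\dots,b_{p-1})$, set $a_0=a_p=1$, $a_j=0$ for $j<0$ or $j>p$, and $b_j=0$ for $j<0$ or $j>p-1$. Let $Q(z)=\sum_{j=0}^p a_jz^{2(p-j)}$ and $P(z)=\sum_{j=0}^{p-1}b_jz^{2(p-1-j)}$, so $Q(1)=\sum_{j=0}^p a_j$. Define $$d_{p+1-j}=\sum_{k=0}^{j}a_{p-k}a_{j-k}\quad(0\le j\le p-1),\qquad d_1=\frac12\sum_{k=0}^p a_{p-k}^2,$$ $$c_j=\sum_{k=0}^{2p-1}a_k\,b_{p-1-j+k}\quad(0\le j\le 2p-1),$$ $$\alpha_p(i)=2^{2i-1}\sum_{k=1}^{p+1-i}\frac{k+i-1}{i}\binom{k+2i-2}{k-1}d_{k+i}\quad(1\le i\le p).$$ Then $\mathbf{x}^+=(a_1^+,\dots,a_{p-1}^+;b_0^+,\dots,b_{p-1}^+)$, where $$a_i^+=\frac{\alpha_p(i)}{2^{2i-1}\,Q(1)^{2(1-i/p)}}\quad(1\le i\le p-1),$$ $$b_i^+=Q(1)^{2i/p+1/p-2}\left[\sum_{k=0}^{p-1-i}(c_k+c_{2p-1-k})\binom{p-1-k+i}{2i}\right]\quad(0\le i\le p-1).$$ The iteration being convergent includes that every $\mathbf{x}_n$ is defined.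
   Formalization: Convergence of the integral is taken to include that the denominator has no zero on [0,∞); zeros cancelled by the numerator are excluded, since there the claim fails (p=2, a_1=-2, b=0: the integral is 0 but Q(1)=0, so x_1 is undefined). *)

(* Defs.v *)
From HB Require Import structures.
From mathcomp Require Import all_boot all_order all_algebra.
From mathcomp Require Import all_classical all_reals all_analysis.

Set Implicit Arguments.
Unset Strict Implicit.
Unset Printing Implicit Defensive.

Import Order.TTheory GRing.Theory Num.Theory.
Import numFieldNormedType.Exports.

Local Open Scope classical_set_scope.
Local Open Scope ring_scope.

(* A parameter vector x = (a_1, ..., a_(p-1); b_0, ..., b_(p-1)).  Ordinals
   start at 0, so a_j is stored as x.1 0 i with i = j - 1, whereas b_j is
   stored as x.2 0 i with i = j. *)
Definition params (R : realType) (p : nat) : Type :=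
  ('rV[R]_p.-1 * 'rV[R]_p)%type.

Section Landen.
Variables (R : realType) (p : nat).
Implicit Type x : params R p.

(* The indices are integers because the formula for c_j below uses b_j with
   negative j. *)
Definition acoef x (j : int) : R :=
  if (j == 0) || (j == p%:Z) then 1
  else if j is Posz i.+1 then oapp (fun k : 'I_p.-1 => x.1 0 k) 0 (insub i)
  else 0.

Definition bcoef x (j : int) : R :=
  if j is Posz i then oapp (fun k : 'I_p => x.2 0 k) 0 (insub i) else 0.

Definition Qpoly x : {poly R} :=
  \sum_(j < p.+1) acoef x j%:Z *: 'X^(2 * (p - j)).

Definition Ppoly x : {poly R} :=
  \sum_(j < p) bcoef x j%:Z *: 'X^(2 * (p - 1 - j)).

Definition integrand x (z : R) : R := (Ppoly x).[z] / (Qpoly x).[z].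

Definition partial_integral x (t : R) : R :=
  (\int[lebesgue_measure]_(z in `[0, t]) integrand x z)%R.

(* Convergence of the improper integral of P/Q over [0, +oo).  Division by 0
   returns 0 here, so the requirement that P/Q be defined (hence continuous)
   on the whole of [0, +oo) has to be stated; in particular real zeros of Q
   are not allowed to be cancelled by zeros of P. *)
Definition integral_converges x : Prop :=
  (forall z : R, 0 <= z -> (Qpoly x).[z] != 0) /\
  cvg (partial_integral x @ +oo).

Definition U x : R := lim (partial_integral x @ +oo).

Definition Q1 x : R := (Qpoly x).[1].

(* y^(m/n) for an integer m and n > 0, as the m-th power of the real n-th root
   of y; the root of a negative y is the negative one, which is meaningful
   for odd n only. *)
Definition ratpow (y : R) (m : int) (n : nat) : R :=
  (Num.sg y * `|y| `^ n%:R^-1) ^ m.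

(* d_m for 1 <= m <= p + 1 *)
Definition dcoef x (m : nat) : R :=
  if m == 1%N then 2^-1 * \sum_(0 <= k < p.+1) acoef x (p - k)%N%:Z ^+ 2
  else let j := (p + 1 - m)%N in
    \sum_(0 <= k < j.+1) acoef x (p - k)%N%:Z * acoef x (j - k)%N%:Z.

Definition ccoef x (j : nat) : R :=
  \sum_(0 <= k < 2 * p) acoef x k%:Z * bcoef x (p%:Z - 1 - j%:Z + k%:Z).

Definition alpha x (i : nat) : R :=
  2 ^+ (2 * i - 1) *
  \sum_(1 <= k < p + 2 - i)
    (k + i - 1)%N%:R / i%:R * 'C(k + 2 * i - 2, k - 1)%:R * dcoef x (k + i).

(* The exponent 2 (1 - i/p) is written 2 (p - i) / p. *)
Definition aplus x (i : nat) : R :=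
  alpha x i / (2 ^+ (2 * i - 1) * ratpow (Q1 x) (2 * (p%:Z - i%:Z)) p).

(* The exponent 2i/p + 1/p - 2 is written (2i + 1 - 2p) / p. *)
Definition bplus x (i : nat) : R :=
  ratpow (Q1 x) (2 * i%:Z + 1 - 2 * p%:Z) p *
  \sum_(0 <= k < p - i)
    (ccoef x k + ccoef x (2 * p - 1 - k)) * 'C(p - 1 - k + i, 2 * i)%:R.

(* x^+ as a total function; it is meaningful when [landen_defined x] holds. *)
Definition landen x : params R p :=
  (\row_(i < p.-1) aplus x i.+1, \row_(i < p) bplus x i).

(* The formulas for b_i^+ involve negative powers of Q(1), with odd numerator
   2i + 1 - 2p over p.  They are defined over the reals iff Q(1) != 0 and, when
   p is even, Q(1) > 0. *)
Definition landen_defined x : Prop :=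
  Q1 x != 0 /\ (~~ odd p -> 0 < Q1 x).

Definition landen_iter x (n : nat) : params R p := iter n landen x.

Definition landen_limit (L : R) : params R p :=
  (\row_(i < p.-1) 'C(p, i.+1)%:R, \row_(i < p) ('C(p.-1, i)%:R * L)).

Definition iteration_converges_to x (l : params R p) : Prop :=
  (forall n, landen_defined (landen_iter x n)) /\
  landen_iter x @ \oo --> l.

End Landen.

(* Main.v *)
From HB Require Import structures.
Require Import Defs.
From mathcomp Require Import all_boot all_order all_algebra.
From mathcomp Require Import all_classical all_reals all_analysis.
From mathcomp Require Import complex.
From mathcomp Require Import zify ring lra.

Import Order.TTheory GRing.Theory Num.Theory.
Import numFieldNormedType.Exports.

Local Open Scope classical_set_scope.
Local Open Scope ring_scope.

Set Implicit Arguments.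
Unset Strict Implicit.
Unset Printing Implicit Defensive.

(** The transformation x |-> x^+ is the change of variables
    y = mu / (z - 1/z), mu = Q(1)^(1/p), which sends z and -1/z to the same
    point: [denp_landen] and [nump_landen] say that P^+/Q^+ dy is the push-forward
    of the measure P/Q dz. For mu = 2 it doubles angles, tan theta becoming
    - tan (2 theta), and the scaling by mu keeps the constant coefficient of Q
    equal to 1.

    Denominators. If Q > 0 on [0, +oo) then Q(z) is a product of p factors
    z^2 + t_i^2 with Re t_i > 0, and the transformation sends t_i to
    mu t_i / (1 + t_i^2). This map multiplies the pseudo-hyperbolic distance of t
    and u in the right half-plane by that of t and 1/u
    ([landen_root_contract]), whatever mu is. Because Q is real the family of
    the t_i contains its conjugates, and the product of the |t_i| is 1;
    therefore a bound on the mutual distances confines the family to a compact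
    set ([spread_bounds]), the contraction is uniform ([spread_contract]) and the
    t_i all tend to 1. Hence Q_n tends to (1 + z^2)^p ([denp_cvg]).

    Integral. With primitives G and G' of P/Q and P^+/Q^+, the sum
    G(z) - G(1/z) + G'(mu / (z - 1/z)) is constant for z > 1
    ([landen_primitive]). Its limits at +oo and at 1 show that the integral
    converges as soon as Q has no zero on [0, +oo), and that P^+/Q^+ has the same
    integral ([partial_integral_cvg], [landen_integral]).

    Numerators. At Q = (1 + z^2)^p the map on numerators is linear and, by the
    doubling of angles, halves the degree of P / (1 + z^2)^(p-1) as a polynomial
    in cos (2 theta), z = tan theta. Its p-th power has rank one, with image
    spanned by (1 + z^2)^(p-1) ([limit_mx_rank1]). So P_(n+p) is close to
    k_n (1 + z^2)^(p-1), up to an error small compared with P_n, and the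
    invariant integral forces k_n to tend to 2 U / pi ([numer_cvg]).

    Converse. A zero of Q on [0, +oo) yields one of every Q_n, which is impossible
    once Q_n is close to (1 + z^2)^p ([iteration_cvg_denp_pos]). *)

(** * Lucas polynomials *)

(** Collecting a double sum along its diagonals: applied to Q(z) Q(1/z), it
    groups the terms into multiples of z^(2m) + z^(-2m). *)
Lemma sum_square_diagonals (V : nmodType) (g : nat -> nat -> V) (n : nat) :
  \sum_(0 <= k < n) \sum_(0 <= l < n) g k l =
  \sum_(0 <= k < n) g k k +
  \sum_(1 <= m < n) \sum_(0 <= k < n - m) (g k (k + m)%N + g (k + m)%N k).
Proof.
elim: n => [|n IHn]; first by rewrite !big_geq // addr0.
have -> : \sum_(1 <= m < n.+1) \sum_(0 <= k < n.+1 - m)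
    (g k (k + m)%N + g (k + m)%N k) =
  \sum_(1 <= m < n) \sum_(0 <= k < n - m) (g k (k + m)%N + g (k + m)%N k) +
  \sum_(0 <= k < n) (g k n + g n k).
  have -> : \sum_(0 <= k < n) (g k n + g n k) =
      \sum_(1 <= m < n.+1) (g (n - m)%N n + g n (n - m)%N).
    rewrite [LHS]big_nat_rev /= big_add1 /=.
    by apply: eq_big_nat => i /andP[_ ltin]; rewrite add0n.
  have -> : \sum_(1 <= m < n) \sum_(0 <= k < n - m)
      (g k (k + m)%N + g (k + m)%N k) =
    \sum_(1 <= m < n.+1) \sum_(0 <= k < n - m)
      (g k (k + m)%N + g (k + m)%N k).
    case: n {IHn} => [|n]; first by rewrite !big_geq.
    by rewrite [in RHS]big_nat_recr //= subnn [X in _ + X]big_geq // addr0.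
  rewrite -big_split /=; apply: eq_big_nat => m /andP[_ lemn].
  by rewrite subSn // big_nat_recr //= subnK.
rewrite big_nat_recr //= [\sum_(0 <= l < n.+1) g n l]big_nat_recr //=.
under eq_bigr do rewrite big_nat_recr //=.
rewrite !big_split /= IHn [\sum_(0 <= k < n.+1) g k k]big_nat_recr //=.
by rewrite [RHS]addrAC !addrA.
Qed.

Section Lucas.
Variable F : numFieldType.

(** The polynomial in (z - 1/z)^2 that represents
    (z^(2m+1) + z^(-2m-1)) / (z + 1/z). *)
Definition lucasV (m : nat) : {poly F} :=
  \poly_(i < m.+1) 'C(m + i, 2 * i)%:R.

Lemma coef_lucasV m i : (lucasV m)`_i = 'C(m + i, 2 * i)%:R.
Proof.
rewrite coef_poly; case: ltnP => // ltmi.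
by rewrite bin_small //; lia.
Qed.

Lemma lucasV_rec m :
  lucasV m.+2 + lucasV m = ('X + 2%:P) * lucasV m.+1.
Proof.
apply/polyP => i; rewrite mulrDl !coefD coefXM coefCM !coef_lucasV.
case: i => [|i] /=; first by rewrite !muln0 !bin0 add0r mulr1 -natrD.
have -> : (m.+2 + i.+1 = (m + i.+1).+2)%N by lia.
have -> : (2 * i.+1 = (2 * i).+2)%N by lia.
have -> : (m.+1 + i.+1 = (m + i.+1).+1)%N by lia.
have -> : (m.+1 + i = m + i.+1)%N by lia.
rewrite -!natrD -natrM -natrD; congr (_%:R).
by rewrite (binS (m + i.+1).+1) !(binS (m + i.+1)); lia.
Qed.

Lemma lucasV_odd_powers (z : F) m : z != 0 ->
  z ^+ (2 * m).+1 + z ^- (2 * m).+1 =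
  (z + z^-1) * (lucasV m).[(z - z^-1) ^+ 2].
Proof.
move=> z0.
have lV0 : lucasV 0 = 1.
  by apply/polyP => -[|i]; rewrite coef_lucasV coef1 //= bin_small //; lia.
have lV1 : lucasV 1 = 'X + 1.
  apply/polyP => -[|[|i]]; rewrite coef_lucasV coefD coefX coef1 //= ?add0r ?addr0//.
  by rewrite bin_small //; lia.
elim/ltn_ind: m => -[|[|m]] IH.
- by rewrite lV0 !hornerE.
- by rewrite lV1 !hornerE; field.
- have /(congr1 (fun p => p.[(z - z^-1) ^+ 2])) := lucasV_rec m.
  rewrite hornerD hornerM => rec.
  have -> : (lucasV m.+2).[(z - z^-1) ^+ 2] =
      ('X + 2%:P).[(z - z^-1) ^+ 2] * (lucasV m.+1).[(z - z^-1) ^+ 2] -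
      (lucasV m).[(z - z^-1) ^+ 2] by rewrite -rec addrK.
  rewrite mulrBr -IH ?leqnSn // mulrCA -IH ?leqnn //.
  have -> : (2 * m.+2).+1 = ((2 * m).+1 + 4)%N by lia.
  have -> : (2 * m.+1).+1 = ((2 * m).+1 + 2)%N by lia.
  have : z ^+ (2 * m).+1 != 0 by rewrite expf_neq0.
  rewrite hornerD hornerX hornerC !exprD; move: (z ^+ (2 * m).+1) => w w0; field.
  by rewrite z0 w0.
Qed.

Lemma lucasV_even_powers (z : F) m : z != 0 -> z + z^-1 != 0 ->
  z ^+ (2 * m.+1) + z ^- (2 * m.+1) =
  (lucasV m.+1 + lucasV m).[(z - z^-1) ^+ 2].
Proof.
move=> z0 zz0; apply: (mulfI zz0).
rewrite hornerD [RHS]mulrDr -!lucasV_odd_powers //.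
have -> : (2 * m.+1).+1 = (2 * m.+1 + 1)%N by lia.
have -> : (2 * m.+1 = (2 * m).+1 + 1)%N by lia.
have : z ^+ (2 * m).+1 != 0 by rewrite expf_neq0.
rewrite !exprD; move: (z ^+ (2 * m).+1) => w w0; field.
by rewrite z0 w0.
Qed.

(** The weights (k+i-1)/i binom(k+2i-2, k-1) in alpha_p(i) are these
    coefficients, with k + i - 1 = m + 1 and the symmetry of binomials. *)
Lemma coef_lucas_even m i : (0 < i)%N ->
  (lucasV m.+1 + lucasV m)`_i =
  m.+1%:R / i%:R * 'C(m + i, (2 * i).-1)%:R :> F.
Proof.
case: i => // i _; rewrite coefD !coef_lucasV.
have i0 : (i.+1%:R : F) != 0 by rewrite pnatr_eq0.
apply: (mulfI i0); rewrite mulrA [i.+1%:R * (_ / _)]mulrCA divff // mulr1.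
rewrite -natrD -!natrM; congr (_%:R).
have -> : (m.+1 + i.+1 = (m + i.+1).+1)%N by lia.
have -> : (2 * i.+1 = (2 * i).+2)%N by lia.
rewrite binS /=.
have := mul_bin_left (m + i.+1) (2 * i).+1.
case: (leqP i m) => [leim|ltmi]; last by rewrite !bin_small //; lia.
set c := 'C(_, (2 * i).+2); set d := 'C(_, (2 * i).+1).
have -> : (m + i.+1 - (2 * i).+1 = m - i)%N by lia.
move=> h; have -> : (i.+1 * (c + d + c) = (2 * i).+2 * c + i.+1 * d)%N by lia.
by rewrite h -mulnDl; congr (_ * _)%N; lia.
Qed.

Lemma size_lucasV m : (size (lucasV m) <= m.+1)%N.
Proof. exact: size_poly. Qed.

End Lucas.

Lemma coef_X1_exp (S : comNzRingType) (n k : nat) :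
  (('X + 1) ^+ n : {poly S})`_k = 'C(n, k)%:R.
Proof.
rewrite addrC exprDn coef_sum.
under eq_bigr do rewrite expr1n mul1r coefMn coefXn.
have [kn|nk] := ltnP k n.+1.
  rewrite (bigD1 (Ordinal kn)) //= eqxx big1 ?addr0 // => i /negP ik.
  by case: eqP => [ki|]; rewrite ?mul0rn //; case: ik; apply/eqP/val_inj.
rewrite bin_small // big1 // => i _; have := ltn_ord i.
by case: eqP => [ki|]; rewrite ?mul0rn //; lia.
Qed.

(** * Functional equations of the Landen transformation *)

Section Algebra.
Variables (R : realType) (p : nat).
Hypothesis hp : (1 <= p)%N.
Implicit Type x : params R p.

(** In y = z^2 the denominator is a polynomial of degree p, whose p roots can be
    followed along the iteration. *)
Definition denp x : {poly R} :=
  \poly_(j < p.+1) acoef x (p - j)%N%:Z.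
Definition nump x : {poly R} :=
  \poly_(j < p) bcoef x (p - 1 - j)%N%:Z.

Lemma Qpoly_denp x z : (Qpoly x).[z] = (denp x).[z ^+ 2].
Proof.
rewrite /Qpoly /denp horner_poly horner_sum (reindex_inj rev_ord_inj) /=.
apply: eq_bigr => i _; rewrite hornerZ hornerXn -exprM subSS.
by rewrite subKn // -ltnS.
Qed.

Lemma Ppoly_nump x z : (Ppoly x).[z] = (nump x).[z ^+ 2].
Proof.
rewrite /Ppoly /nump horner_poly horner_sum (reindex_inj rev_ord_inj) /=.
apply: eq_bigr => i _; rewrite hornerZ hornerXn -exprM.
have h := ltn_ord i.
have -> : (p - i.+1 = p - 1 - i)%N by lia.
by rewrite subKn //; lia.
Qed.

Lemma acoef0 x : acoef x 0 = 1. Proof. by rewrite /acoef eqxx. Qed.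
Lemma acoefp x : acoef x p%:Z = 1.
Proof. by rewrite /acoef eqxx orbT. Qed.
Lemma acoef_out x (j : nat) : (p < j)%N -> acoef x j%:Z = 0.
Proof.
case: j => // j ltpj; rewrite /acoef /= ifN; last by lia.
by rewrite insubN //; lia.
Qed.
Lemma acoef_in x (i : 'I_p.-1) : acoef x i.+1%:Z = x.1 0 i.
Proof.
have h := ltn_ord i; rewrite /acoef ifN; last by lia.
by rewrite valK.
Qed.
Lemma bcoef_in x (i : 'I_p) : bcoef x i%:Z = x.2 0 i.
Proof. by rewrite /bcoef valK. Qed.
Lemma bcoef_out x (i : int) : p%:Z <= i -> bcoef x i = 0.
Proof. by case: i => // i h; rewrite /bcoef insubN //; lia. Qed.
Lemma bcoef_neg x (i : int) : i < 0 -> bcoef x i = 0.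
Proof. by case: i. Qed.

(** The number mu with mu^p = Q(1) whose powers are the fractional powers of
    Q(1) in x^+. *)
Definition Q1root x : R := Num.sg (Q1 x) * `|Q1 x| `^ p%:R^-1.

Lemma Q1_root x : landen_defined x -> Q1root x ^+ p = Q1 x.
Proof.
move=> [Q0 Qeven]; rewrite /Q1root exprMn -[(_ `^ _) ^+ _]powR_mulrn ?powR_ge0 //.
rewrite -powRrM mulVf ?pnatr_eq0 -?lt0n // powRr1 //.
have [odd_p|even_p] := boolP (odd p).
  by rewrite sgr_odd // odd_p expr1 -numEsg.
by rewrite !gtr0_sg ?Qeven // gtr0_norm ?Qeven // expr1n mul1r.
Qed.

Lemma Q1root_neq0 x : landen_defined x -> Q1root x != 0.
Proof.
move=> [Q0 _]; rewrite /Q1root mulf_neq0 ?sgr_eq0 //.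
by rewrite powR_eq0 negb_and normr_eq0 Q0.
Qed.

(** The polynomial N with Q(z) Q(1/z) = N((z - 1/z)^2). *)
Definition normpoly x : {poly R} :=
  (2 * dcoef x 1)%:P +
  \sum_(1 <= m < p.+1) dcoef x m.+1 *: (lucasV R m + lucasV R m.-1).

Lemma addV_neq0 (z : R) : z != 0 -> z + z^-1 != 0.
Proof.
move=> z0; apply/eqP => /(congr1 ( *%R z)); rewrite mulrDr divff // mulr0.
have := sqr_ge0 z; rewrite expr2; lra.
Qed.

Lemma subV_neq0 (z : R) : z != 0 -> z ^+ 2 != 1 -> z - z^-1 != 0.
Proof.
move=> z0; apply: contra; rewrite subr_eq0 => /eqP zz.
by rewrite expr2 {2}zz mulfV.
Qed.

Lemma denp_sum x (y : R) :
  (denp x).[y] = \sum_(0 <= k < p.+1) acoef x (p - k)%N%:Z * y ^+ k.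
Proof. by rewrite /denp horner_poly big_mkord. Qed.

Lemma dcoef1 x :
  2 * dcoef x 1 = \sum_(0 <= k < p.+1) acoef x (p - k)%N%:Z ^+ 2.
Proof. by rewrite /dcoef /= mulrA divff ?mul1r // pnatr_eq0. Qed.

Lemma dcoefS x m : (0 < m < p.+1)%N ->
  dcoef x m.+1 = \sum_(0 <= k < p.+1 - m)
     acoef x (p - k)%N%:Z * acoef x (p - (k + m))%N%:Z.
Proof.
move=> /andP[m0 mp]; rewrite /dcoef eqSS gtn_eqF //.
have -> : (p + 1 - m.+1).+1 = (p.+1 - m)%N by lia.
apply: eq_big_nat => k /andP[_ hk]; congr (_ * acoef x (Posz _)); lia.
Qed.

Lemma horner_normpoly x (z : R) : z != 0 ->
  (normpoly x).[(z - z^-1) ^+ 2] = (denp x).[z ^+ 2] * (denp x).[z ^- 2].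
Proof.
move=> z0; rewrite !denp_sum mulr_suml.
under [RHS]eq_bigr do rewrite mulr_sumr.
rewrite sum_square_diagonals hornerD hornerC dcoef1 horner_sum; congr (_ + _).
  apply: eq_bigr => k _; rewrite expr2 mulrACA -exprMn mulfV ?expr1n ?mulr1 //.
  exact: expf_neq0.
apply: eq_big_nat => -[//|m] hm; rewrite hornerZ -lucasV_even_powers ?addV_neq0 //.
rewrite dcoefS // mulr_suml; apply: eq_bigr => k _.
have zz : z ^+ 2 != 0 by rewrite expf_neq0.
rewrite !exprD !exprVn !exprM; move: (z ^+ 2) zz => y y0.
have yk : y ^+ k != 0 by rewrite expf_neq0.
have ym : y ^+ m.+1 != 0 by rewrite expf_neq0.
move: (y ^+ k) (y ^+ m.+1) yk ym => u v u0 v0.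
by field; rewrite u0 v0.
Qed.

Lemma coef_normpoly x i : (0 < i < p.+1)%N ->
  (normpoly x)`_i = alpha x i / 2 ^+ (2 * i - 1).
Proof.
move=> /andP[i0 ip]; rewrite /alpha mulrAC divff ?expf_neq0 ?pnatr_eq0 // mul1r.
rewrite coefD coefC gtn_eqF // add0r coef_sum (big_cat_nat (n := i)) //=; last exact: ltnW.
rewrite big_nat_cond big1 ?add0r; last first.
  move=> m /andP[/andP[m0 mi] _]; case: m m0 mi => // m _ mi.
  by rewrite coefZ coef_lucas_even // bin_small ?mulr0 ?mulr0 //; lia.
rewrite -{1}(prednK i0) -add1n big_addn.
have -> : (p.+1 - i.-1 = p + 2 - i)%N by lia.
apply: eq_big_nat => k /andP[k0 _].
have -> : (k + i.-1 = (k + i - 2).+1)%N by lia.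
rewrite coefZ /= coef_lucas_even // mulrC.
have -> : ((k + i - 2).+2 = k + i)%N by lia.
have -> : ((k + i - 2).+1 = k + i - 1)%N by lia.
congr (_ * _%:R * _); rewrite -[RHS]bin_sub; last by lia.
by congr 'C(_, _); lia.
Qed.

Lemma coef_normpoly0 x : (normpoly x)`_0 = Q1 x ^+ 2.
Proof.
rewrite -horner_coef0; have := horner_normpoly x (oner_neq0 R).
by rewrite invr1 subrr expr0n expr1n invr1 /= -[_ * _]expr2 => ->; rewrite /Q1 Qpoly_denp expr1n.
Qed.

Lemma coef_normpolyp x : (normpoly x)`_p = 1.
Proof.
rewrite coefD coefC gtn_eqF // add0r coef_sum big_nat_recr //= big_nat_cond big1.
  rewrite add0r coefZ coefD !coef_lucasV addnn -mul2n binn bin_small; last by lia.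
  rewrite addr0 mulr1 dcoefS ?hp //= subSnn big_nat1 subn0 add0n subnn.
  by rewrite acoefp acoef0 mulr1.
move=> m /andP[/andP[m0 mp] _].
by rewrite coefZ coefD !coef_lucasV !bin_small ?addr0 ?mulr0 //; lia.
Qed.

Lemma size_normpoly x : (size (normpoly x) <= p.+1)%N.
Proof.
apply: (leq_trans (size_polyD _ _)); rewrite geq_max (leq_trans (size_polyC_leq1 _)) //=.
apply: (leq_trans (size_sum _ _ _)).
apply/bigmax_leqP_seq => m; rewrite mem_index_iota => /andP[m0 mp] _.
apply: (leq_trans (size_scale_leq _ _)); apply: (leq_trans (size_polyD _ _)).
rewrite geq_max; apply/andP; split; apply: (leq_trans (size_lucasV _ _)); lia.
Qed.

Lemma acoef_landen x i : landen_defined x -> (i <= p)%N ->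
  acoef (landen x) i%:Z =
  (normpoly x)`_i * Q1root x ^+ (2 * i) / Q1root x ^+ (2 * p).
Proof.
move=> def_x ip; have mu0 := Q1root_neq0 def_x.
case: i ip => [_|i ip].
  rewrite acoef0 coef_normpoly0 muln0 expr0 mulr1 [in X in _ / X]mulnC exprM.
  by rewrite Q1_root // divff // expf_neq0 //; case: def_x.
have [->|nip] := eqVneq i.+1 p.
  by rewrite acoefp coef_normpolyp mul1r divff // expf_neq0.
have ltip : (i < p.-1)%N by lia.
rewrite (acoef_in (landen x) (Ordinal ltip)) mxE /aplus coef_normpoly /=; last by lia.
rewrite /ratpow -/(Q1root x) invfM -!mulrA; congr (_ * (_ * _)).
have -> : 2 * (p%:Z - i.+1%:Z) = (2 * (p - i.+1))%N%:Z by lia.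
have -> : (2 * p = 2 * (p - i.+1) + 2 * i.+1)%N by lia.
rewrite -exprnP exprD [in RHS]invfM; congr (_ * _).
rewrite [RHS]mulrCA divff ?mulr1 //.
exact: expf_neq0.
Qed.

(** The coefficients of Q^+ are those of N in reverse order, up to powers of
    mu. Hence Q^+(y) = Q(z) Q(1/z) / (z - 1/z)^(2p) at y = mu / (z - 1/z), a
    point that has the two preimages z and -1/z. *)
Lemma denp_landen x (z : R) : landen_defined x -> z != 0 -> z ^+ 2 != 1 ->
  (denp (landen x)).[Q1root x ^+ 2 / (z - z^-1) ^+ 2] =
  (denp x).[z ^+ 2] * (denp x).[z ^- 2] / (z - z^-1) ^+ (2 * p).
Proof.
move=> def_x z0 z1; have mu0 := Q1root_neq0 def_x.
have u0 := subV_neq0 z0 z1.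
rewrite -horner_normpoly // (horner_coef_wide _ (size_normpoly x)).
rewrite denp_sum big_mkord (reindex_inj rev_ord_inj) /= mulr_suml.
apply: eq_bigr => i _; have hi := ltn_ord i; rewrite subSS subKn //.
rewrite acoef_landen //.
move: (z - z^-1) u0 (Q1root x) mu0 => u u0 mu mu0.
rewrite expr_div_n -!exprM -!mulrA; congr (_ * _).
have -> : (2 * p = 2 * i + 2 * (p - i))%N by lia.
move: (2 * i)%N (2 * (p - i))%N => k l; rewrite !exprD.
have := expf_neq0 k mu0; have := expf_neq0 l mu0.
have := expf_neq0 k u0; have := expf_neq0 l u0.
move: (u ^+ k) (u ^+ l) (mu ^+ k) (mu ^+ l) => a b c d b0 a0 d0 c0.
by field; rewrite a0 b0 c0 d0.
Qed.

Lemma nump_sum x (y : R) :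
  (nump x).[y] = \sum_(0 <= k < p) bcoef x (p - 1 - k)%N%:Z * y ^+ k.
Proof. by rewrite /nump horner_poly big_mkord. Qed.

(** The c_j are the coefficients of z P(z) Q(1/z), an odd Laurent polynomial
    with exponents from 1 - 2p to 2p - 1. *)
Lemma ccoef_sum x (z : R) : z != 0 ->
  \sum_(0 <= j < 2 * p) ccoef x j * (z ^+ (2 * j).+1 / z ^+ (2 * p)) =
  z * (nump x).[z ^+ 2] * (denp x).[z ^- 2].
Proof.
move=> z0; rewrite denp_sum -mulrA mulr_sumr mulr_sumr.
under eq_bigr do rewrite mulr_suml.
rewrite exchange_big /= (big_cat_nat (n := p.+1)) //=; last by lia.
rewrite [X in _ + X]big_nat_cond [X in _ + X]big1 ?addr0; last first.
  move=> k /andP[/andP[pk _] _]; rewrite big1 // => j _.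
  by rewrite acoef_out // !mul0r.
rewrite [RHS]big_nat_rev /= add0n; apply: eq_big_nat => k /andP[_ kp].
rewrite subSS subKn //.
rewrite (big_cat_nat (n := k)) //=; last by lia.
rewrite [X in X + _]big_nat_cond [X in X + _]big1 ?add0r; last first.
  by move=> j /andP[/andP[_ jk] _]; rewrite bcoef_out ?mulr0 ?mul0r //; lia.
rewrite (big_cat_nat (n := (k + p)%N)) //=; [|lia|lia].
rewrite [X in _ + X]big_nat_cond [X in _ + X]big1 ?addr0; last first.
  by move=> j /andP[/andP[kj _] _]; rewrite bcoef_neg ?mulr0 ?mul0r //; lia.
rewrite -{1}[k]add0n big_addn addKn nump_sum mulr_suml mulr_sumr.
apply: eq_big_nat => m /andP[_ mp].
have -> : p%:Z - 1 - (m + k)%N%:Z + k%:Z = (p - 1 - m)%N%:Z by lia.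
have -> : (2 * p = 2 * k + 2 * (p - k))%N by lia.
have -> : ((2 * (m + k)).+1 = 1 + 2 * m + 2 * k)%N by lia.
rewrite exprVn -!exprM; move: (2 * k)%N (2 * (p - k))%N (2 * m)%N => k' l m'.
rewrite !exprD expr1; have := expf_neq0 k' z0; have := expf_neq0 l z0.
move: (z ^+ k') (z ^+ l) (z ^+ m') => c d e d0 c0.
by field; rewrite c0 d0.
Qed.

Lemma ccoef_sumV x (z : R) : z != 0 ->
  \sum_(0 <= j < 2 * p) ccoef x (2 * p - 1 - j) * (z ^+ (2 * j).+1 / z ^+ (2 * p)) =
  z^-1 * (nump x).[z ^- 2] * (denp x).[z ^+ 2].
Proof.
move=> z0; have := @ccoef_sum x z^-1; rewrite invr_eq0 => /(_ z0).
rewrite !exprVn !invrK => <-.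
rewrite big_nat_rev /= add0n; apply: eq_big_nat => j /andP[_ jp].
congr (ccoef x _ * _); first by lia.
rewrite exprVn.
apply: (mulIf (expf_neq0 (2 * p) z0)); rewrite mulfVK ?expf_neq0 //.
rewrite -mulrA -exprD; apply: (mulfI (expf_neq0 (2 * j).+1 z0)).
rewrite mulVKf ?expf_neq0 // -exprD; congr (_ ^+ _); lia.
Qed.

Lemma bcoef_landen x i : (i < p)%N -> bcoef (landen x) i%:Z = bplus x i.
Proof. by move=> ip; rewrite (bcoef_in (landen x) (Ordinal ip)) mxE. Qed.

Definition bplus_sum x i : R := \sum_(0 <= k < p - i)
    (ccoef x k + ccoef x (2 * p - 1 - k)) * 'C(p - 1 - k + i, 2 * i)%:R.

(** Symmetrizing under z <-> 1/z makes the odd Laurent polynomial a multiple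
    of z + 1/z, with a quotient in (z - 1/z)^2 given by Lucas polynomials. *)
Lemma bplus_sumE x (z : R) : z != 0 ->
  (z + z^-1) * \sum_(0 <= i < p) bplus_sum x i * (z - z^-1) ^+ (2 * i) =
  z * (nump x).[z ^+ 2] * (denp x).[z ^- 2] +
  z^-1 * (nump x).[z ^- 2] * (denp x).[z ^+ 2].
Proof.
move=> z0; rewrite -ccoef_sum // -ccoef_sumV //.
have eqV : \sum_(0 <= i < p) bplus_sum x i * (z - z^-1) ^+ (2 * i) =
  \sum_(0 <= k < p) (ccoef x k + ccoef x (2 * p - 1 - k)) *
     (lucasV R (p - 1 - k)).[(z - z^-1) ^+ 2].
  have -> : \sum_(0 <= i < p) bplus_sum x i * (z - z^-1) ^+ (2 * i) =
     \sum_(0 <= i < p) \sum_(0 <= k < p) (ccoef x k + ccoef x (2 * p - 1 - k)) *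
       'C(p - 1 - k + i, 2 * i)%:R * (z - z^-1) ^+ (2 * i).
    apply: eq_big_nat => i /andP[_ ip]; rewrite /bplus_sum mulr_suml.
    rewrite [RHS](big_cat_nat (n := (p - i)%N)) //=; last by lia.
    rewrite [X in _ = _ + X]big_nat_cond [X in _ = _ + X]big1 ?addr0 //.
    move=> k /andP[/andP[ik kp] _]; rewrite bin_small ?mulr0 ?mul0r //; lia.
  rewrite exchange_big /=; apply: eq_big_nat => k /andP[_ kp].
  rewrite (@horner_coef_wide _ p); last by apply: leq_trans (size_lucasV _ _) _; lia.
  rewrite mulr_sumr big_mkord; apply: eq_bigr => i _.
  by rewrite coef_lucasV -mulrA exprM.
rewrite eqV mulr_sumr -big_split /= [RHS](big_cat_nat (n := p)) //=; last by lia.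
have -> : \sum_(p <= i < 2 * p)
      (ccoef x i * (z ^+ (2 * i).+1 / z ^+ (2 * p)) +
       ccoef x (2 * p - 1 - i) * (z ^+ (2 * i).+1 / z ^+ (2 * p))) =
    \sum_(0 <= k < p) (ccoef x k + ccoef x (2 * p - 1 - k)) *
       z ^+ (2 * (p - 1 - k)).+1.
  rewrite -{1}[p]add0n big_addn [(2 * p - p)%N](_ : _ = p); last by lia.
  rewrite big_nat_rev /= add0n; apply: eq_big_nat => k /andP[_ kp].
  have -> : (p - k.+1 + p = 2 * p - 1 - k)%N by lia.
  have -> : (2 * p - 1 - (2 * p - 1 - k) = k)%N by lia.
  have -> : ((2 * (2 * p - 1 - k)).+1 = (2 * (p - 1 - k)).+1 + 2 * p)%N by lia.
  by rewrite -mulrDl [ccoef x k + _]addrC exprD mulfK // expf_neq0.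
rewrite -big_split; apply: eq_big_nat => k /andP[_ kp] /=.
rewrite mulrCA -lucasV_odd_powers // mulrDr addrC -mulrDl; congr (_ * _ + _).
have -> : (2 * p = (2 * k).+1 + (2 * (p - 1 - k)).+1)%N by lia.
move: (2 * k).+1 (2 * (p - 1 - k)).+1 => m n.
by rewrite exprD invfM mulVKf // expf_neq0.
Qed.

(** Together with [denp_landen], this identifies the measure P^+/Q^+ dy with the
    push-forward of P/Q dz under y = mu / (z - 1/z). *)
Lemma nump_landen x (z : R) : landen_defined x -> z != 0 -> z ^+ 2 != 1 ->
  (nump (landen x)).[Q1root x ^+ 2 / (z - z^-1) ^+ 2] =
  (z * (nump x).[z ^+ 2] * (denp x).[z ^- 2] +
   z^-1 * (nump x).[z ^- 2] * (denp x).[z ^+ 2]) /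
  ((z + z^-1) * Q1root x * (z - z^-1) ^+ (2 * (p - 1))).
Proof.
move=> def_x z0 z1; have mu0 := Q1root_neq0 def_x.
have u0 := subV_neq0 z0 z1.
have v0 := addV_neq0 z0.
rewrite -bplus_sumE //; move: (z + z^-1) (z - z^-1) v0 u0 => v u v0 u0.
have [mu muE] : {mu | Q1root x = mu} by exists (Q1root x).
rewrite muE in mu0 *; rewrite -[v * mu * _]mulrA [in RHS]invfM [RHS]mulrACA divff // mul1r.
rewrite nump_sum big_nat_rev add0n mulr_suml; apply: eq_big_nat => i /andP[_ ip].
have -> : (p - 1 - (p - i.+1) = i)%N by lia.
rewrite bcoef_landen // /bplus /ratpow -/(Q1root x) muE -/(bplus_sum x i).
have -> : (2 * i%:Z + 1 - 2 * p%:Z) = - (2 * (p - i.+1)).+1%:Z by lia.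
have -> : (2 * (p - 1) = 2 * (p - i.+1) + 2 * i)%N by lia.
rewrite -exprnN [in RHS]exprD expr_div_n -!exprM.
rewrite exprS; move: (2 * i)%N (2 * (p - i.+1))%N => k l.
have := expf_neq0 l mu0; have := expf_neq0 l u0; have := expf_neq0 k u0.
move: (u ^+ k) (u ^+ l) (mu ^+ l) => a b c a0 b0 c0.
by field; rewrite mu0 a0 b0 c0.
Qed.
End Algebra.

(** * Contraction in the right half-plane *)

Section Contraction.
Variable R : rcfType.
Local Notation C := R[i].
Local Notation Re := (@complex.Re R).
Local Notation Im := (@complex.Im R).
Local Notation "x %:C" := (real_complex R x).
Implicit Types t u : C.

(** The squared modulus as an element of R; the norm of R[i] takes its values
    in R[i]. *)
Definition normsq t : R := Re t ^+ 2 + Im t ^+ 2.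

Lemma normsqM t u : normsq (t * u) = normsq t * normsq u.
Proof. by case: t u => a b [c d]; rewrite /normsq /=; ring. Qed.

Lemma normsq1 : normsq 1 = 1.
Proof. by rewrite /normsq /= expr1n expr0n addr0. Qed.

Lemma normsqJ t : normsq (conjc t) = normsq t.
Proof. by case: t => a b; rewrite /normsq /= sqrrN. Qed.

Lemma normsq_ge0 t : 0 <= normsq t.
Proof. by rewrite addr_ge0 ?sqr_ge0. Qed.

Lemma normsq_eq0 t : (normsq t == 0) = (t == 0).
Proof.
by case: t => a b; rewrite /normsq eq_complex /= paddr_eq0 ?sqr_ge0 ?sqrf_eq0.
Qed.

Lemma normsqV t : t != 0 -> normsq t^-1 = (normsq t)^-1.
Proof.
move=> t0; have n0 : normsq t != 0 by rewrite normsq_eq0.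
by apply: (mulfI n0); rewrite mulfV // -normsqM mulfV // normsq1.
Qed.

Lemma normsq_prod (I : finType) (F : I -> C) :
  normsq (\prod_i F i) = \prod_i normsq (F i).
Proof. exact: (big_morph _ normsqM normsq1). Qed.

(** Bounds the square of |t - u| / |t + conj u|, the pseudo-hyperbolic distance
    of the right half-plane. *)
Definition pseudo_hyp_le (D : R) t u :=
  normsq (t - u) <= D * normsq (t + conjc u).

(** The effect of the transformation on the roots -t^2 of the denominator in
    y = z^2; the reciprocal of the value is (t + 1/t) / mu. *)
Definition landen_root (mu : R) t : C := mu%:C * (t / (1 + t ^+ 2)).

Lemma right_half_plane_neq0 t : 0 < Re t -> t != 0.
Proof. by case: t => a b /= a0; rewrite eq_complex /= gt_eqF //=. Qed.

Lemma one_add_sqr_neq0 t : 0 < Re t -> 1 + t ^+ 2 != 0.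
Proof.
case: t => a b /= a0; rewrite expr2 eq_complex /=.
apply/negP => /andP[/eqP h1 /eqP h2].
have b0 : b = 0.
  by apply: (mulfI (lt0r_neq0 a0)); rewrite mulr0; lra.
have := sqr_ge0 a; rewrite b0 in h1; lra.
Qed.

Lemma Re_landen_root mu t : 0 < mu -> 0 < Re t -> 0 < Re (landen_root mu t).
Proof.
move=> mu0 t0; have d0 := one_add_sqr_neq0 t0.
have n0 : 0 < normsq (1 + t ^+ 2).
  by rewrite lt0r normsq_ge0 andbT normsq_eq0.
have -> : Re (landen_root mu t) =
    mu * (Re t * (1 + normsq t)) / normsq (1 + t ^+ 2).
  rewrite /landen_root; case: t {t0 d0 n0} => a b.
  by rewrite /normsq expr2 /=; set d := _ ^+ 2 + _ ^+ 2; ring.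
rewrite divr_gt0 // !mulr_gt0 //; have := normsq_ge0 t; lra.
Qed.

Lemma landen_rootJ mu t : conjc (landen_root mu t) = landen_root mu (conjc t).
Proof.
by rewrite /landen_root !rmorphM fmorphV rmorphD rmorph1 rmorphXn /= oppr0.
Qed.

(** The differences factor, and |1 - t u| / |1 + t conj u| is the distance of t
    to 1/u: the distance of the images is the distance of t and u times that of
    t and 1/u, independently of mu. *)
Lemma landen_root_contract (mu D k : R) t u : 0 < mu -> 0 < Re t -> 0 < Re u ->
  0 <= k -> pseudo_hyp_le D t u ->
  normsq (1 - t * u) <= k * normsq (1 + t * conjc u) ->
  pseudo_hyp_le (k * D) (landen_root mu t) (landen_root mu u).
Proof.
move=> mu0 t0 u0 k0 tu tuV; have Ju0 : 0 < Re (conjc u) by case: (u) u0.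
have dt := one_add_sqr_neq0 t0; have du := one_add_sqr_neq0 u0.
have dJu := one_add_sqr_neq0 Ju0.
rewrite /pseudo_hyp_le landen_rootJ /landen_root -mulrBr -mulrDr !normsqM.
have -> : t / (1 + t ^+ 2) - u / (1 + u ^+ 2) =
    (t - u) * (1 - t * u) * ((1 + t ^+ 2)^-1 * (1 + u ^+ 2)^-1).
  by field; rewrite dt du.
have -> : t / (1 + t ^+ 2) + conjc u / (1 + conjc u ^+ 2) =
    (t + conjc u) * (1 + t * conjc u) *
      ((1 + t ^+ 2)^-1 * (1 + conjc u ^+ 2)^-1).
  by field; rewrite dt dJu.
have -> : 1 + conjc u ^+ 2 = conjc (1 + u ^+ 2).
  by rewrite rmorphD rmorph1 rmorphXn.
rewrite !normsqM !normsqV ?conjc_eq0 // normsqJ.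
have mu2 : 0 < normsq mu%:C by rewrite /normsq /= expr0n addr0 exprn_gt0.
rewrite [leRHS]mulrCA (ler_pM2l mu2).
rewrite [leRHS]mulrA; apply: ler_wpM2r.
  by rewrite mulr_ge0 ?invr_ge0 ?normsq_ge0.
by rewrite [k * D]mulrC mulrACA ler_pM ?normsq_ge0.
Qed.

Lemma normsq_one_addJ_subM t u :
  normsq (1 + t * conjc u) - normsq (1 - t * u) = 4 * (Re t * Re u).
Proof. by case: t u => a b [c d]; rewrite /normsq /=; ring. Qed.

Lemma pseudo_hyp_Re D t u : 0 <= D < 1 -> pseudo_hyp_le D t u ->
  (1 - D) * (Re t + Re u) ^+ 2 <= 4 * (Re t * Re u).
Proof.
case: t u => a b [c d] /andP[D0 D1]; rewrite /pseudo_hyp_le /normsq /=.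
have : 0 <= (1 - D) * (b - d) ^+ 2 by rewrite mulr_ge0 ?sqr_ge0 ?subr_ge0 ?ltW.
move: (b - d) => e; move=> h1 h2; lra.
Qed.

Variable p : nat.
Hypothesis hp : (0 < p)%N.
Implicit Type s : 'I_p -> C.

(** Properties of the t_i when -t_i^2 are the roots of a real polynomial with
    constant coefficient 1 and no root on the half-line y >= 0. *)
Definition admissible s : Prop :=
  [/\ forall i, 0 < Re (s i), forall i, exists j, s j = conjc (s i)
    & \prod_i normsq (s i) = 1].

Definition spread_le (D : R) s : Prop := forall i j, pseudo_hyp_le D (s i) (s j).

Lemma exists_prod_le1 (F : 'I_p -> R) : (forall i, 0 <= F i) ->
  \prod_i F i = 1 -> exists i, F i <= 1.
Proof.
move=> F0 prodF; apply/existsP; apply/contraT; rewrite negb_exists => /forallP h.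
suff : (\prod_(i < p) (1 : R)) < \prod_i F i by rewrite prodF big1 // ltxx.
apply: ltr_prod; first by apply/hasP; exists (Ordinal hp); rewrite ?mem_index_enum.
by move=> i _; rewrite ler01 ltNge h.
Qed.

Lemma exists_prod_ge1 (F : 'I_p -> R) : (forall i, 0 <= F i) ->
  \prod_i F i = 1 -> exists i, 1 <= F i.
Proof.
move=> F0 prodF; apply/existsP; apply/contraT; rewrite negb_exists => /forallP h.
suff : \prod_i F i < (\prod_(i < p) (1 : R)) by rewrite prodF big1 // ltxx.
apply: ltr_prod; first by apply/hasP; exists (Ordinal hp); rewrite ?mem_index_enum.
by move=> i _; rewrite F0 ltNge h.
Qed.

(** The conjugate of a member is a member too, and the distance of t to its
    conjugate is |Im t| / |t|. *)
Lemma spread_angle D s i : admissible s -> spread_le D s ->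
  Im (s i) ^+ 2 <= D * normsq (s i).
Proof.
move=> [_ sJ _] /(_ i) si; have [j sj] := sJ i; move: (si j).
rewrite /pseudo_hyp_le sj; case: (s i) => a b; rewrite /normsq /=; nra.
Qed.

Lemma spread_Re2 D s i : admissible s -> spread_le D s ->
  (1 - D) * normsq (s i) <= Re (s i) ^+ 2.
Proof. by move=> /spread_angle h /h => /(_ i); rewrite /normsq; lra. Qed.

(** As the arguments stay away from a right angle, it is enough to compare real
    parts, and [pseudo_hyp_Re] gives (1 - D) Re t <= 4 Re u. *)
Lemma spread_comparable D s i j : 0 <= D < 1 -> admissible s -> spread_le D s ->
  normsq (s i) <= 16 / (1 - D) ^+ 3 * normsq (s j).
Proof.
move=> D01 adm sD; have /andP[D0 D1] := D01.
have := pseudo_hyp_Re D01 (sD i j); have := spread_Re2 i adm sD.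
have [pos _ _] := adm; move: (pos i) (pos j).
have : Re (s j) ^+ 2 <= normsq (s j) by rewrite lerDl sqr_ge0.
move: (Re (s i)) (Re (s j)) (normsq _) (normsq _) => a c n m hm a0 c0 hn ac.
have e0 : 0 < 1 - D by lra.
move: hn ac e0; move: (1 - D) => e hn ac e0.
rewrite mulrAC ler_pdivlMr ?exprn_gt0 //.
have h1 : e * a <= 4 * c by nra.
have h2 : (e * a) ^+ 2 <= (4 * c) ^+ 2 by rewrite lerXn2r ?nnegrE; nra.
have h3 : e ^+ 2 * (e * n) <= e ^+ 2 * a ^+ 2 by rewrite ler_pM2l ?exprn_gt0.
rewrite exprMn in h2; rewrite exprMn in h2; lra.
Qed.

(** The moduli are comparable and their product is 1, so some are at most 1 and
    some are at least 1. *)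
Lemma spread_bounds D s i : 0 <= D < 1 -> admissible s -> spread_le D s ->
  (16 / (1 - D) ^+ 3)^-1 <= normsq (s i) <= 16 / (1 - D) ^+ 3.
Proof.
pose M := 16 / (1 - D) ^+ 3; rewrite -/M => D01 adm sD; have /andP[D0 D1] := D01.
have M0 : 0 < M by rewrite divr_gt0 ?exprn_gt0 ?subr_gt0.
have [_ _ prod1] := adm.
have [j hj] := exists_prod_le1 (fun i => normsq_ge0 (s i)) prod1.
have [k hk] := exists_prod_ge1 (fun i => normsq_ge0 (s i)) prod1.
have h1 := spread_comparable i j D01 adm sD.
have h2 := spread_comparable k i D01 adm sD.
rewrite -/M in h1 h2; apply/andP; split.
  by rewrite -div1r ler_pdivrMr // mulrC (le_trans hk).
by apply: le_trans h1 _; rewrite ger_pMr.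
Qed.

(** By [spread_bounds] the family lies in a compact part of the half-plane, on
    which the distance of t to 1/u is bounded away from 1. The factor k depends
    only on D, a bound that the next families satisfy too; hence k serves for the
    whole iteration. *)
Lemma spread_contract D : 0 <= D < 1 -> exists2 k, 0 <= k < 1 &
  forall (mu D' : R) s, 0 < mu -> admissible s -> spread_le D s ->
    spread_le D' s -> spread_le (k * D') (fun i => landen_root mu (s i)).
Proof.
move=> D01; have /andP[D0 D1] := D01.
pose M := 16 / (1 - D) ^+ 3; pose m := (1 - D) / M.
have e0 : 0 < 1 - D by rewrite subr_gt0.
have M0 : 0 < M by rewrite divr_gt0 ?exprn_gt0 ?subr_gt0.
have M1 : 1 <= M.
  rewrite ler_pdivlMr ?exprn_gt0 // mul1r.
  have : (1 - D) ^+ 3 <= 1 by apply: exprn_ile1; lra.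
  lra.
have m0 : 0 < m by rewrite divr_gt0.
have m1 : m <= 1 by rewrite ler_pdivrMr // mul1r; lra.
have M2 : 0 < M ^+ 2 + 1 by rewrite ltr_wpDl ?sqr_ge0.
(* 4 Re t Re u >= 4 m by the bounds below, and |1 + t conj u|^2 <= 2 (M^2 + 1) *)
exists (1 - 2 * m / (M ^+ 2 + 1)).
  have c0 : 0 < 2 * m / (M ^+ 2 + 1) by apply: divr_gt0 => //; apply: mulr_gt0.
  rewrite gtrBl c0 andbT subr_ge0 ler_pdivrMr // mul1r.
  have := sqr_ge0 (M - 1); nra.
move=> mu D' s mu0 adm sD sD' i j; have [pos _ _] := adm.
have [pi pj] := (pos i, pos j).
apply: landen_root_contract => //.
  rewrite subr_ge0 ler_pdivrMr // mul1r.
  have := sqr_ge0 (M - 1); nra.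
have par := normsq_one_addJ_subM (s i) (s j).
have /andP[bi Bi] := spread_bounds i D01 adm sD.
have /andP[bj Bj] := spread_bounds j D01 adm sD.
have ri := spread_Re2 i adm sD; have rj := spread_Re2 j adm sD.
rewrite -/M in bi Bi bj Bj.
have mi : m <= Re (s i) ^+ 2 by apply: le_trans ri; rewrite ler_pM2l.
have mj : m <= Re (s j) ^+ 2 by apply: le_trans rj; rewrite ler_pM2l.
have rij : m <= Re (s i) * Re (s j).
  move: mi mj pi pj; move: (Re (s i)) (Re (s j)) => x y.
  by case: (lerP x y) => xy; nra.
have up : normsq (1 + s i * conjc (s j)) <= 2 * (M ^+ 2 + 1).
  have : normsq (s i * conjc (s j)) <= M ^+ 2.
    by rewrite normsqM normsqJ expr2 ler_pM ?normsq_ge0.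
  move: (s i * _) => w; case: w => a b; rewrite /normsq /= => h.
  have := sqr_ge0 (a - 1); have := sqr_ge0 b; nra.
rewrite mulrBl mul1r lerBrDr -lerBrDl par.
rewrite mulrAC ler_pdivrMr //; nra.
Qed.

(** A family of small spread consists of nearly real numbers that are close to
    each other; as the product of their moduli is 1, they are close to 1. *)
Lemma spread_close D : 0 <= D < 1 -> exists2 K, 0 < K &
  forall D' s i, 0 <= D' -> admissible s -> spread_le D s -> spread_le D' s ->
   `|Re (s i) - 1| <= 2 * Num.sqrt (D' * K) /\ `|Im (s i)| <= Num.sqrt (D' * K).
Proof.
move=> D01; have /andP[D0 D1] := D01.
pose M := 16 / (1 - D) ^+ 3; exists (4 * M).
  by rewrite mulr_gt0 // divr_gt0 ?exprn_gt0 ?subr_gt0.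
move=> D' s i D'0 adm sD sD'.
have M0 : 0 < M by rewrite divr_gt0 ?exprn_gt0 ?subr_gt0.
have DM0 : 0 <= D' * (4 * M) by apply: mulr_ge0 => //; apply: mulr_ge0 => //; exact: ltW.
have [pos sJ prod1] := adm.
have le_sqrt (a : R) : a ^+ 2 <= D' * (4 * M) -> `|a| <= Num.sqrt (D' * (4 * M)).
  by move=> h; rewrite -sqrtr_sqr ler_sqrt.
have imD j : `|Im (s j)| <= Num.sqrt (D' * (4 * M)).
  apply: le_sqrt; apply: le_trans (spread_angle j adm sD') _.
  rewrite ler_wpM2l //; have /andP[_] := spread_bounds j D01 adm sD.
  rewrite -/M; lra.
split; last exact: imD.
have reD j k : `|Re (s j) - Re (s k)| <= Num.sqrt (D' * (4 * M)).
  apply: le_sqrt; have := sD' j k; rewrite /pseudo_hyp_le.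
  have /andP[_] := spread_bounds j D01 adm sD.
  have /andP[_] := spread_bounds k D01 adm sD.
  rewrite -/M; case: (s j) (s k) => a b [c d]; rewrite /normsq /= => h1 h2 h3.
  have h4 : (a + c) ^+ 2 + (b - d) ^+ 2 <= 4 * M.
    have := sqr_ge0 (a - c); have := sqr_ge0 (b + d); nra.
  have := ler_wpM2l D'0 h4; have := sqr_ge0 (b - d); lra.
have [j hj] := exists_prod_le1 (fun i => normsq_ge0 (s i)) prod1.
have [k hk] := exists_prod_ge1 (fun i => normsq_ge0 (s i)) prod1.
have e0 : 0 <= Num.sqrt (D' * (4 * M)) := sqrtr_ge0 _.
have := reD i j; have := reD i k; have := imD k; have := pos k; have := pos j.
move: hj hk e0; rewrite /normsq; move: (Num.sqrt _) => e.
move: (Re (s i)) (Re (s j)) (Re (s k)) (Im (s k)) (Im (s j)) => x y z v w.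
move=> hj hk e0 y0 z0 /ler_normlP[v1 v2] /ler_normlP[xz1 xz2] /ler_normlP[xy1 xy2].
have v2e : v ^+ 2 <= e ^+ 2 by nra.
have y1 : y <= 1 by have := sqr_ge0 w; nra.
have z1 : 1 <= z + e by nra.
by apply/ler_normlP; split; lra.
Qed.

Lemma spread_init s : admissible s -> exists2 D, 0 <= D < 1 & spread_le D s.
Proof.
move=> [pos _ _].
pose F (ij : 'I_p * 'I_p) := normsq (s ij.1 - s ij.2) / normsq (s ij.1 + conjc (s ij.2)).
have dpos i j : 0 < normsq (s i + conjc (s j)).
  rewrite lt0r normsq_ge0 normsq_eq0 andbT right_half_plane_neq0 //.
  by have := pos i; have := pos j; case: (s i) (s j) => a b [c d] /=; lra.
exists (\big[Num.max/0]_ij F ij).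
  apply/andP; split; first exact: bigmax_ge_id.
  apply: bigmax_lt => // -[i j] _.
  rewrite /F ltr_pdivrMr //= mul1r -subr_gt0.
  have -> : normsq (s i + conjc (s j)) - normsq (s i - s j) = 4 * (Re (s i) * Re (s j)).
    by case: (s i) (s j) => a b [c d]; rewrite /normsq /=; ring.
  by rewrite !mulr_gt0.
move=> i j; rewrite /pseudo_hyp_le -ler_pdivrMr //.
exact: (le_bigmax _ F (i, j)).
Qed.

End Contraction.

(** * Roots of the denominator *)

(** The points n + 1 are positive: the functional equations determine x^+ on
    positive arguments only. *)
Lemma poly_eq_on_nat (F : numDomainType) (f g : {poly F}) :
  (forall n : nat, f.[n.+1%:R] = g.[n.+1%:R]) -> f = g.
Proof.
move=> fg; apply/eqP; rewrite -subr_eq0; apply/eqP.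
apply: (@roots_geq_poly_eq0 _ _ [seq n.+1%:R | n <- iota 0 (size (f - g))]).
- by apply/allP => _ /mapP[n _ ->]; rewrite rootE hornerD hornerN fg subrr.
- by rewrite map_inj_uniq ?iota_uniq // => m n /eqP; rewrite eqr_nat => /eqP[].
- by rewrite size_map size_iota.
Qed.

Section Roots.
Variables (R : realType) (p : nat).
Hypothesis hp : (1 <= p)%N.
Implicit Type x : params R p.
Local Notation C := R[i].
Local Notation "x %:C" := (real_complex R x).

Definition denp_pos x := forall y : R, 0 <= y -> 0 < (denp x).[y].

Lemma size_denp x : size (denp x) = p.+1.
Proof. by apply: size_poly_eq; rewrite subnn acoef0 oner_neq0. Qed.

Lemma denp_monic x : denp x \is monic.
Proof.
by rewrite monicE lead_coefE size_denp coef_poly /= ltnSn subnn acoef0.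
Qed.

Lemma denp0 x : (denp x).[0] = 1.
Proof. by rewrite horner_coef0 coef_poly subn0 acoefp. Qed.

(** Q(0) = 1, so that a Q without zeros on the half-line is positive there. *)
Lemma denp_posP x :
  denp_pos x <-> (forall z : R, 0 <= z -> (Qpoly x).[z] != 0).
Proof.
split=> [xpos z z0|Qn0 y y0].
  by rewrite Qpoly_denp gt_eqF // xpos // sqr_ge0.
rewrite ltNge; apply/negP => qy.
have : (- denp x).[0] <= 0 <= (- denp x).[y].
  by rewrite !hornerN denp0 oppr_le0 ler01 oppr_ge0.
move=> /(poly_ivt y0)[w /andP[w0 _]]; rewrite rootE hornerN oppr_eq0 => /eqP qw.
by have := Qn0 _ (sqrtr_ge0 w); rewrite Qpoly_denp sqr_sqrtr // qw eqxx.
Qed.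

Lemma denp_pos_defined x : denp_pos x -> landen_defined x.
Proof.
move=> xpos; have Q0 : 0 < Q1 x by rewrite /Q1 Qpoly_denp expr1n xpos.
by split=> [|_]; rewrite ?gt_eqF.
Qed.

Lemma Q1root_gt0 x : denp_pos x -> 0 < Q1root x.
Proof.
move=> xpos; have Q0 : 0 < Q1 x by rewrite /Q1 Qpoly_denp expr1n xpos.
by rewrite /Q1root gtr0_sg // mul1r powR_gt0 // normr_gt0 gt_eqF.
Qed.

(** The solution z of z - 1/z = u with z > 1 when u > 0. *)
Definition zsol (u : R) : R := (u + Num.sqrt (u ^+ 2 + 4)) / 2.

Lemma zsolP (u : R) : 0 < u -> 1 < zsol u /\ zsol u - (zsol u)^-1 = u.
Proof.
move=> u0; have e0 : 0 <= u ^+ 2 + 4 by have := sqr_ge0 u; lra.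
rewrite /zsol; set s := Num.sqrt _.
have s2 : s ^+ 2 = u ^+ 2 + 4 by rewrite sqr_sqrtr.
have s0 : 0 <= s := sqrtr_ge0 _.
have s_gt2 : 2 < s by rewrite ltNge; apply/negP => s2le; nra.
split; first by lra.
have -> : ((u + s) / 2)^-1 = (s - u) / 2.
  apply: (mulfI (_ : (u + s) / 2 != 0)); first by apply: lt0r_neq0; lra.
  by rewrite mulfV; [field: s2|apply: lt0r_neq0; lra].
by field.
Qed.

Lemma landen_preimage (mu y : R) : 0 < mu -> 0 < y ->
  exists2 z : R, 1 < z & z - z^-1 = mu / y.
Proof.
by move=> mu0 y0; have [] := zsolP (divr_gt0 mu0 y0); exists (zsol (mu / y)).
Qed.

(** Every y > 0 has a preimage z > 1, and [denp_landen] gives the sign. *)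
Lemma denp_pos_landen x : denp_pos x -> denp_pos (landen x).
Proof.
move=> xpos y; rewrite le_eqVlt => /predU1P[<-|y0]; first by rewrite denp0.
have y20 : 0 < Num.sqrt y by rewrite sqrtr_gt0.
have mu0 := Q1root_gt0 xpos.
have [z z1 uz] := landen_preimage mu0 y20.
have z0 : 0 < z := lt_trans ltr01 z1.
have := denp_landen hp (denp_pos_defined xpos) (lt0r_neq0 z0).
rewrite uz expr_div_n sqr_sqrtr ?ltW // invfM invrK mulrA mulfV ?mul1r; last first.
  by rewrite expf_neq0 // lt0r_neq0.
move=> ->; last by rewrite gt_eqF // expr2; nra.
rewrite divr_gt0 ?mulr_gt0 ?xpos ?invr_ge0 ?sqr_ge0 // exprn_gt0 //.
by rewrite divr_gt0.
Qed.

Definition roots_of x (t : 'I_p -> C) : Prop :=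
  map_poly (real_complex R) (denp x) = \prod_i ('X + (t i ^+ 2)%:P).

Lemma roots_of_horner x t (y : R) : roots_of x t ->
  ((denp x).[y])%:C = \prod_i (y%:C + t i ^+ 2).
Proof.
move=> /(congr1 (fun f => f.[y%:C])); rewrite horner_map => ->.
by rewrite horner_prod; apply: eq_bigr => i _; rewrite hornerD hornerX hornerC.
Qed.

(** With s = t_i^2 and mu^p = Q(1) = prod (1 + s), the factors
    (z^2 + s) (z^(-2) + s) / (z - 1/z)^2 of Q^+(y) are, up to constants of
    product 1, the y^2 + mu^2 s / (1 + s)^2. *)
Lemma roots_of_landen x t : denp_pos x -> (forall i, 0 < complex.Re (t i)) ->
  roots_of x t -> roots_of (landen x) (fun i => landen_root (Q1root x) (t i)).
Proof.
move=> xpos tpos xt; apply: poly_eq_on_nat => n.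
have y0 : 0 < n.+1%:R :> R by rewrite ltr0n.
rewrite -[n.+1%:R](rmorph_nat (real_complex R)) horner_map.
move: (n.+1%:R : R) y0 => y y0; rewrite horner_prod.
under eq_bigr do rewrite hornerD hornerX hornerC.
have y20 : 0 < Num.sqrt y by rewrite sqrtr_gt0.
have mu0 := Q1root_gt0 xpos.
have [z z1 uz] := landen_preimage mu0 y20.
have z0 : 0 < z := lt_trans ltr01 z1.
have := denp_landen hp (denp_pos_defined xpos) (lt0r_neq0 z0).
have u0 : 0 < z - z^-1 by rewrite uz divr_gt0.
have -> : Q1root x ^+ 2 / (z - z^-1) ^+ 2 = y.
  rewrite uz expr_div_n sqr_sqrtr ?ltW // invfM invrK mulrA mulfV ?mul1r //.
  by rewrite expf_neq0 // lt0r_neq0.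
move=> ->; last by rewrite gt_eqF // expr2; nra.
have Q1E : \prod_i (1 + t i ^+ 2) ^+ 2 = \prod_(i < p) (Q1root x)%:C ^+ 2.
  rewrite !prodrXl prodr_const card_ord -rmorphXn /=.
  rewrite (Q1_root hp (denp_pos_defined xpos)) /Q1 Qpoly_denp expr1n.
  by rewrite (roots_of_horner 1 xt).
have yE : y = Q1root x ^+ 2 / (z - z^-1) ^+ 2.
  rewrite uz expr_div_n sqr_sqrtr ?ltW // invfM invrK mulrA mulfV ?mul1r //.
  by rewrite expf_neq0 // lt0r_neq0.
rewrite rmorphM fmorphV rmorphM /= !(roots_of_horner _ xt) exprM.
have -> : (((z - z^-1) ^+ 2) ^+ p)%:C = \prod_(i < p) ((z - z^-1)%:C) ^+ 2.
  by rewrite prodr_const card_ord !rmorphXn.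
have mu20 : \prod_(i < p) (Q1root x)%:C ^+ 2 != 0.
  apply/prodf_neq0 => i _; rewrite expf_neq0 //.
  by rewrite (fmorph_eq0 (real_complex R)) lt0r_neq0.
rewrite -[RHS](mulfK mu20) -{1}Q1E -prodfV -!big_split /= -prodfV -big_split /=.
apply: eq_bigr => i _; rewrite yE.
have := one_add_sqr_neq0 (tpos i); rewrite /landen_root.
have [u uE] : {u | z - z^-1 = u} by exists (z - z^-1).
move: u0; rewrite uE => /lt0r_neq0 u_neq0.
move: (Q1root x) (lt0r_neq0 mu0) => mu mu_neq0 s0; have z_neq0 := lt0r_neq0 z0.
have : mu%:C != 0 by rewrite (fmorph_eq0 (real_complex R)).
have : u%:C != 0 by rewrite (fmorph_eq0 (real_complex R)).
have : z%:C != 0 by rewrite (fmorph_eq0 (real_complex R)).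
have : u%:C = z%:C - (z%:C)^-1 by rewrite -uE rmorphB fmorphV.
rewrite !(rmorphM, fmorphV, rmorphXn) /=.
move: (z%:C) (u%:C) (mu%:C) (t i) s0 => Z U M s s0 -> Z0 U0 M0.
have Z1 : Z * Z - 1 != 0.
  apply: contra U0 => /eqP h; have -> : Z - Z^-1 = (Z * Z - 1) / Z by field.
  by rewrite h mul0r.
by field; rewrite M0 s0 Z0.
Qed.

Lemma admissible_roots x t : (forall i, 0 < complex.Re (t i)) ->
  (forall i, exists j, t j = conjc (t i)) -> roots_of x t -> admissible t.
Proof.
move=> tpos tJ xt; split=> //.
have := roots_of_horner 0 xt; rewrite denp0.
under eq_bigr do rewrite add0r.
move=> /(congr1 (@normsq R)); rewrite normsq_prod normsq1.
under eq_bigr do rewrite expr2 normsqM -expr2.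
rewrite prodrXl => /esym/eqP; rewrite sqrf_eq1 => /orP[/eqP //|/eqP h].
have : 0 <= \prod_i normsq (t i) by rewrite prodr_ge0 // => i _; rewrite normsq_ge0.
by rewrite h oppr_ge0 ler10.
Qed.

(** A root r outside of the half-line y >= 0 is -t^2 for exactly one t with
    Re t > 0, which makes the choice of t commute with conjugation. *)
Lemma roots_of_exist x : denp_pos x -> exists t, roots_of x t /\ admissible t.
Proof.
move=> xpos; have [r denpE] := closed_field_poly_normal (map_poly (real_complex R) (denp x)).
rewrite lead_coef_map (monicP (denp_monic x)) rmorph1 scale1r in denpE.
have size_r : size r = p.
  have := congr1 (fun f : {poly C} => size f) denpE.
  by rewrite size_map_poly size_denp size_prod_XsubC => -[].
pose w (i : 'I_p) := sqrtc (- r`_i).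
pose t (i : 'I_p) : C := if 0 < complex.Re (w i) then w i else - w i.
have t2 i : t i ^+ 2 = - r`_i.
  by rewrite /t; case: ifP => _; rewrite ?sqrrN sqr_sqrtc.
have xt : roots_of x t.
  rewrite /roots_of denpE (big_nth 0) size_r big_mkord.
  by apply: eq_bigr => i _; rewrite t2 polyCN.
have root_r (i : 'I_p) : root (map_poly (real_complex R) (denp x)) r`_i.
  by rewrite denpE root_prod_XsubC mem_nth // size_r.
have Re_w i : complex.Re (w i) != 0.
  apply/eqP => w0; have := root_r i; rewrite -[r`_i]opprK -t2 /t.
  have -> : - (if 0 < complex.Re (w i) then w i else - w i) ^+ 2 =
      (complex.Im (w i) ^+ 2)%:C.
    rewrite w0 ltxx sqrrN; move: w0; case: (w i) => a b /= ->.
    by apply/eqP; rewrite eq_complex /= expr2; apply/andP; split; apply/eqP; ring.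
  by rewrite rootE horner_map fmorph_eq0 gt_eqF // xpos ?sqr_ge0.
have tpos i : 0 < complex.Re (t i).
  rewrite /t; case: ifP => // /negbT; rewrite -leNgt le_eqVlt (negbTE (Re_w i)) /=.
  by case: (w i) => a b /=; rewrite oppr_gt0.
exists t; split=> //; apply: admissible_roots xt => //.
move=> i; have : root (map_poly (real_complex R) (denp x)) (conjc r`_i).
    rewrite -complex_root_conj -map_poly_comp.
    rewrite (eq_map_poly (_ : conjc \o real_complex R =1 real_complex R)) //.
    by move=> a /=; rewrite oppr0.
  rewrite denpE root_prod_XsubC => /(nthP 0)[j]; rewrite size_r => jp rj.
  exists (Ordinal jp); apply/eqP.
  have : t (Ordinal jp) ^+ 2 == conjc (t i) ^+ 2.
    by rewrite t2 -rmorphXn t2 rmorphN /= rj.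
  rewrite eqf_sqr => /orP[//|/eqP tj].
  have := tpos (Ordinal jp); rewrite tj; have := tpos i.
  by case: (t i) => a b /= a0; rewrite oppr_gt0 ltNge ltW.
Qed.

End Roots.

(** * Convergence of the denominators *)

Section ComplexLimits.
Variable R : realType.
Local Notation C := R[i].
Local Notation "x %:C" := (real_complex R x).

Definition cvgC (u : nat -> C) (l : C) : Prop :=
  (fun n => complex.Re (u n)) @ \oo --> complex.Re l /\
  (fun n => complex.Im (u n)) @ \oo --> complex.Im l.

Lemma cvgC_cst l : cvgC (fun=> l) l.
Proof. by split; apply: cvg_cst. Qed.

Lemma cvgCD u v l m : cvgC u l -> cvgC v m -> cvgC (fun n => u n + v n) (l + m).
Proof.
move=> [ur ui] [vr vi]; split.
  have -> : (fun n => complex.Re (u n + v n)) =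
    (fun n => complex.Re (u n) + complex.Re (v n)).
    by apply/funext => n; case: (u n) (v n) => a b [].
  have -> : complex.Re (l + m) = complex.Re l + complex.Re m.
    by case: (l) (m) => a b [].
  exact: cvgD.
have -> : (fun n => complex.Im (u n + v n)) =
  (fun n => complex.Im (u n) + complex.Im (v n)).
  by apply/funext => n; case: (u n) (v n) => a b [].
have -> : complex.Im (l + m) = complex.Im l + complex.Im m.
  by case: (l) (m) => a b [].
exact: cvgD.
Qed.

Lemma cvgCM u v l m : cvgC u l -> cvgC v m -> cvgC (fun n => u n * v n) (l * m).
Proof.
move=> [ur ui] [vr vi]; split.
  have -> : (fun n => complex.Re (u n * v n)) =
    (fun n => complex.Re (u n) * complex.Re (v n) - complex.Im (u n) * complex.Im (v n)).
    by apply/funext => n; case: (u n) (v n) => a b [].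
  have -> : complex.Re (l * m) = complex.Re l * complex.Re m - complex.Im l * complex.Im m.
    by case: (l) (m) => a b [].
  by apply: cvgB; apply: cvgM.
have -> : (fun n => complex.Im (u n * v n)) =
  (fun n => complex.Re (u n) * complex.Im (v n) + complex.Im (u n) * complex.Re (v n)).
  by apply/funext => n; case: (u n) (v n) => a b [].
have -> : complex.Im (l * m) = complex.Re l * complex.Im m + complex.Im l * complex.Re m.
  by case: (l) (m) => a b [].
by apply: cvgD; apply: cvgM.
Qed.

Lemma cvgC_sum (I : Type) (r : seq I) (u : I -> nat -> C) (l : I -> C) :
  (forall i, cvgC (u i) (l i)) ->
  cvgC (fun n => \sum_(i <- r) u i n) (\sum_(i <- r) l i).
Proof.
move=> ul; elim: r => [|i r IH].
  by rewrite big_nil; under [X in cvgC X]funext do rewrite big_nil; exact: cvgC_cst.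
rewrite big_cons; under [X in cvgC X]funext do rewrite big_cons.
exact: cvgCD.
Qed.

Definition cvg_coefs (f : nat -> {poly C}) (g : {poly C}) : Prop :=
  forall k, cvgC (fun n => (f n)`_k) g`_k.

Lemma cvg_coefs_prod (I : Type) (r : seq I) (f : I -> nat -> {poly C}) (g : I -> {poly C}) :
  (forall i, cvg_coefs (f i) (g i)) ->
  cvg_coefs (fun n => \prod_(i <- r) f i n) (\prod_(i <- r) g i).
Proof.
move=> fg; elim: r => [|i r IH] k.
  by rewrite big_nil; under [X in cvgC X]funext do rewrite big_nil; exact: cvgC_cst.
rewrite big_cons coefM; under [X in cvgC X]funext do rewrite big_cons coefM.
by apply: cvgC_sum => j; apply: cvgCM; [exact: fg|exact: IH].
Qed.

End ComplexLimits.

Section RootsLimit.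
Variables (R : realType) (p : nat).
Hypothesis hp : (1 <= p)%N.
Implicit Type x : params R p.
Local Notation C := R[i].
Local Notation "x %:C" := (real_complex R x).

Fixpoint roots_iter x (t : 'I_p -> C) n : 'I_p -> C :=
  if n is m.+1 then fun i => landen_root (Q1root (landen_iter x m)) (roots_iter x t m i)
  else t.

Lemma denp_pos_iter x n : denp_pos x -> denp_pos (landen_iter x n).
Proof. by move=> xpos; elim: n => //= n IH; apply: denp_pos_landen. Qed.

Lemma roots_iter_ok x t n : denp_pos x -> roots_of x t -> admissible t ->
  roots_of (landen_iter x n) (roots_iter x t n) /\ admissible (roots_iter x t n).
Proof.
move=> xpos xt tadm; elim: n => [//|n [IHr [tpos tJ _]]] /=.
have ypos := denp_pos_iter n xpos; have mu0 := Q1root_gt0 ypos.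
have yt := roots_of_landen hp ypos tpos IHr; split => //.
apply: admissible_roots yt => [i|i]; first exact: Re_landen_root.
by have [j tj] := tJ i; exists j; rewrite landen_rootJ tj.
Qed.

(** The spread of the n-th family is at most k^n D by [spread_contract], and
    [spread_close] turns this into convergence to 1. *)
Lemma roots_iter_cvg x t : denp_pos x -> roots_of x t -> admissible t ->
  forall i, cvgC (fun n => roots_iter x t n i) 1.
Proof.
move=> xpos xt tadm.
have [D D01 tD] := spread_init tadm.
have [k /andP[k0 k1] contract] := spread_contract hp D01.
have [K K0 close] := spread_close hp D01.
have /andP[D0 D1] := D01.
have ok n := roots_iter_ok n xpos xt tadm.
have tn n : spread_le (k ^+ n * D) (roots_iter x t n) /\ spread_le D (roots_iter x t n).
  elim: n => [|n [IH IHD]]; first by rewrite expr0 mul1r.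
  have mu0 := Q1root_gt0 (denp_pos_iter n xpos).
  have [_ adm] := ok n.
  have := contract _ _ _ mu0 adm IHD IH; have := contract _ _ _ mu0 adm IHD IHD.
  rewrite /= mulrA -exprS => h1 h2; split=> // i j; apply: le_trans (h1 i j) _.
  by apply: ler_wpM2r; [exact: normsq_ge0|apply: ler_piMl => //; exact: ltW].
have e0 : (fun n => Num.sqrt (k ^+ n * D * K)) @ \oo --> (0 : R).
  have h : (fun n => k ^+ n * D * K) @ \oo --> (0 : R).
    rewrite -(mul0r K) -(mul0r D); apply: cvgMl; apply: cvgMl.
    by apply: cvg_expr; rewrite ger0_norm.
  rewrite -(sqrtr0 R); apply: continuous_cvg h.
  exact: sqrt_continuous.
have bnd n i : `|complex.Re (roots_iter x t n i) - 1| <= 2 * Num.sqrt (k ^+ n * D * K) /\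
    `|complex.Im (roots_iter x t n i)| <= Num.sqrt (k ^+ n * D * K).
  by apply: close; [rewrite mulr_ge0 ?exprn_ge0|exact: (ok n).2|exact: (tn n).2|exact: (tn n).1].
have squeeze (u : nat -> R) (l c : R) : (forall n, `|u n - l| <= c * Num.sqrt (k ^+ n * D * K)) ->
    u @ \oo --> l.
  move=> ul; apply/cvgrPdist_le => e e_gt0.
  have ce : (fun n => c * Num.sqrt (k ^+ n * D * K)) @ \oo --> (0 : R).
    by rewrite -(mulr0 c); apply: cvgM e0; exact: cvg_cst.
  move/cvgrPdist_le: ce => /(_ e e_gt0); apply: filterS => n; rewrite sub0r normrN distrC => h.
  by apply: le_trans (ul n) (le_trans (ler_norm _) h).
move=> i; split; first by apply: (squeeze _ _ 2) => n; exact: (bnd n i).1.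
by apply: (squeeze _ _ 1) => n; rewrite mul1r subr0; exact: (bnd n i).2.
Qed.

Lemma denp_cvg x k : denp_pos x ->
  (fun n => (denp (landen_iter x n))`_k) @ \oo --> ('C(p, k)%:R : R).
Proof.
move=> xpos; have [t [xt tadm]] := roots_of_exist xpos.
pose f (i : 'I_p) n := 'X + (roots_iter x t n i ^+ 2)%:P.
have fcvg i : cvg_coefs (f i) ('X + 1).
  move=> j; rewrite coefD; under [X in cvgC X]funext do rewrite /f coefD coefC.
  apply: cvgCD; first exact: cvgC_cst.
  rewrite coef1; case: (j == 0)%N; last exact: cvgC_cst.
  rewrite -[1%:R](mulr1 1); under [X in cvgC X]funext do rewrite expr2.
  by apply: cvgCM; apply: roots_iter_cvg.
have [+ _] := cvg_coefs_prod (index_enum 'I_p) fcvg k.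
have -> : (\prod_(i < p) ('X + 1) : {poly C})`_k = ('C(p, k)%:R).
  by rewrite prodr_const card_ord coef_X1_exp.
rewrite -(rmorph_nat (real_complex R)) /=.
move=> fk; rewrite (_ : (fun n => _) = (fun n => complex.Re (\prod_i f i n)`_k)) //.
apply/funext => n; have [<- _] := roots_iter_ok n xpos xt tadm.
by rewrite coef_map.
Qed.

End RootsLimit.

(** * Sums of limits and primitives on the half-line *)

Lemma cvg_sumr (R : realType) (I : Type) (r : seq I) (u : I -> nat -> R) (l : I -> R) :
  (forall i, u i n @[n --> \oo] --> l i) ->
  \sum_(i <- r) u i n @[n --> \oo] --> \sum_(i <- r) l i.
Proof. by move=> ul; apply: cvg_big => [|i _]; [exact: add_continuous|exact: ul]. Qed.

Section Primitive.
Variable R : realType.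
Implicit Types f g G : R -> R.

(** Starting the integration at -1 gives a primitive that is differentiable,
    hence continuous, at 0 as well. *)
Lemma integral_primitive f : continuous f -> exists G : R -> R,
  [/\ G 0 = 0, forall t : R, -1 < t -> is_derive t 1 G (f t) &
   forall t : R, 0 <= t -> (\int[lebesgue_measure]_(z in `[0, t]) f z)%R = G t].
Proof.
move=> cf.
have fint a b : lebesgue_measure.-integrable `[a, b] (EFin \o f).
  apply: continuous_compact_integrable; first exact: segment_compact.
  exact: continuous_subspaceT.
pose F t := (\int[lebesgue_measure]_(z in `[(-1)%R, t]) f z)%R.
exists (fun t => F t - F 0); split; first by rewrite subrr.
  move=> t t1; have tt : t < t + 1 by rewrite ltrDl.
  have [dF dFt] := continuous_FTC1_closed tt (fint _ _) t1 (cf t).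
  have isF : is_derive t 1 F (f t) by apply: DeriveDef => //; rewrite -derive1E.
  by rewrite -[f t]subr0; apply: is_deriveB.
move=> t t0; rewrite /F Rintegral_itvB ?fint //= ?bnd_simp //.
rewrite Rintegral_itv_obnd_cbnd //; apply: integrableS (fint 0 t) => //.
exact: subset_itv_oc_cc.
Qed.

Lemma is_derive_nondecreasing f g (a : R) :
  (forall t : R, a <= t -> is_derive t 1 f (g t)) -> (forall t : R, a <= t -> 0 <= g t) ->
  {in `[a, +oo[ &, {homo f : x y / x <= y}}.
Proof.
move=> df g0 x y; rewrite !in_itv /= !andbT => ax ay; rewrite le_eqVlt => /predU1P[->//|xy].
have [||c] := @MVT R f g x y xy.
- by move=> z; rewrite in_itv /= => /andP[xz _]; apply: df; rewrite (le_trans ax) // ltW.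
- apply: derivable_within_continuous => z; rewrite in_itv /= => /andP[xz _].
  by have [] := df z (le_trans ax xz).
rewrite in_itv /= -subr_ge0 => /andP[xc _] ->.
by rewrite mulr_ge0 ?subr_ge0 ?(ltW xy) // g0 // (le_trans ax) // ltW.
Qed.

Lemma is_derive0_cst f (a : R) : (forall t : R, a < t -> is_derive t 1 f 0) ->
  forall x y, a < x -> a < y -> f x = f y.
Proof.
move=> df; suff h x y : a < x -> x <= y -> f x = f y.
  move=> x y ax ay; case: (leP x y) => [|/ltW] xy; first exact: h.
  by apply/esym; exact: h.
move=> ax xy; have df' t : x <= t -> is_derive t 1 f 0.
  by move=> xt; apply: df; exact: lt_le_trans xt.
have dNf t : x <= t -> is_derive t 1 (- f) 0.
  by move=> /df' ?; rewrite -[X in is_derive _ _ _ X]oppr0; exact: is_deriveN.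
have xx : x \in `[x, +oo[ by rewrite in_itv /= lexx.
have yx : y \in `[x, +oo[ by rewrite in_itv /= xy.
apply/eqP; rewrite eq_le (is_derive_nondecreasing df') //=.
by have := is_derive_nondecreasing dNf (fun t _ => lexx 0) xx yx xy; rewrite lerN2.
Qed.

(** The derivative of M atan dominates that of G, and atan is at most pi / 2. *)
Lemma primitive_bound G f (M : R) : G 0 = 0 ->
  (forall t : R, 0 <= t -> is_derive t 1 G (f t)) ->
  (forall t : R, 0 <= t -> `|f t| <= M / (1 + t ^+ 2)) ->
  forall t : R, 0 <= t -> `|G t| <= M * (pi / 2).
Proof.
move=> G0 dG fM t t0.
have M0 : 0 <= M.
  by have := fM 0 (lexx 0); rewrite expr0n addr0 divr1; apply: le_trans.
have atan_le : M * atan t <= M * (pi / 2) by rewrite ler_wpM2l // ltW // atan_ltpi2.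
have zz : (0 : R) \in `[0, +oo[ by rewrite in_itv /= lexx.
have tz : t \in `[0, +oo[ by rewrite in_itv /= t0.
apply: le_trans atan_le; apply/ler_normlP; split.
  have dK (s : R) : 0 <= s ->
    is_derive s 1 (fun s : R => M * atan s + G s) (M * (1 + s ^+ 2)^-1 + f s).
    by move=> s0; have := dG s s0 => ?; apply: is_deriveD; exact: is_deriveZ.
  have := is_derive_nondecreasing dK _ zz tz t0.
  rewrite atan0 mulr0 G0 addr0 => h; rewrite -subr_ge0 opprK; apply: h => s s0.
  by have /ler_normlP[+ _] := fM s s0; rewrite -subr_ge0 opprK.
have dK (s : R) : 0 <= s ->
    is_derive s 1 (fun s : R => M * atan s - G s) (M * (1 + s ^+ 2)^-1 - f s).
  by move=> s0; have := dG s s0 => ?; apply: is_deriveB; exact: is_deriveZ.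
have := is_derive_nondecreasing dK _ zz tz t0.
rewrite atan0 mulr0 G0 subr0 => h; rewrite -subr_ge0; apply: h => s s0.
by have /ler_normlP[_] := fM s s0; rewrite -subr_ge0.
Qed.

End Primitive.

(** * Invariance of the integral *)

Section Invariance.
Variables (R : realType) (p : nat).
Hypothesis hp : (1 <= p)%N.
Implicit Type x : params R p.

Lemma integrandE x z : integrand x z = (nump x).[z ^+ 2] / (denp x).[z ^+ 2].
Proof. by rewrite /integrand Ppoly_nump // Qpoly_denp. Qed. 

Lemma continuous_integrand x : denp_pos x -> continuous (integrand x).
Proof.
move=> xpos z; apply: cvgM; first exact: continuous_horner.
apply: cvgV; last exact: continuous_horner.
by rewrite Qpoly_denp gt_eqF // xpos // sqr_ge0.
Qed.

Lemma partial_integral_primitive x : denp_pos x -> exists G : R -> R,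
  [/\ G 0 = 0, forall t : R, -1 < t -> is_derive t 1 G (integrand x t) &
   forall t : R, 0 <= t -> partial_integral x t = G t].
Proof. by move=> /continuous_integrand; exact: integral_primitive. Qed.

Lemma partial_integral_cvgE x (G : R -> R) (l : R) :
  (forall t : R, 0 <= t -> partial_integral x t = G t) ->
  (partial_integral x @ +oo --> l) = (G @ +oo --> l).
Proof.
move=> xG; apply/propext; split; apply: cvg_trans; apply: near_eq_cvg.
  by near=> t; rewrite xG //; near: t; apply: nbhs_pinfty_ge; exact: num_real.
by near=> t; rewrite xG //; near: t; apply: nbhs_pinfty_ge; exact: num_real.
Unshelve. all: by end_near.
Qed.

(** The density of the push-forward of P/Q dz is a sum over the preimages z and
    -1/z; the latter contributes at 1/z because P/Q is even. *)
Lemma integrand_landen x (z : R) : denp_pos x -> 1 < z ->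
  integrand (landen x) (Q1root x / (z - z^-1)) =
  (z - z^-1) ^+ 2 / (Q1root x * (z + z^-1)) *
  (z * integrand x z + z^-1 * integrand x z^-1).
Proof.
move=> xpos z1; have z_gt0 : 0 < z := lt_trans ltr01 z1.
have z0 := lt0r_neq0 z_gt0.
have defx := denp_pos_defined xpos.
have z2 : z ^+ 2 != 1 by rewrite gt_eqF // expr2; nra.
have u0 := subV_neq0 z0 z2.
rewrite !integrandE expr_div_n denp_landen // nump_landen // exprVn.
have := xpos _ (sqr_ge0 z) => /lt0r_neq0.
have : 0 <= z ^- 2 by rewrite invr_ge0 sqr_ge0.
move=> /xpos /lt0r_neq0; have := Q1root_neq0 defx.
have := addV_neq0 z0; have := expf_neq0 (2 * (p - 1)) u0.
have -> : (2 * p = 2 + 2 * (p - 1))%N by lia.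
rewrite exprD.
move: ((z - z^-1) ^+ (2 * (p - 1))) (z - z^-1) u0 (z + z^-1) (Q1root x) => w u u0 v mu.
move: (denp x).[_] (denp x).[_] (nump x).[_] (nump x).[_] => a b c d.
by move=> w0 v0 mu0 b0 a0; field; rewrite mu0 u0 v0 w0 z0 a0 b0.
Qed.

Lemma is_derive_continuous (f : R -> R) (t l : R) :
  is_derive t 1 f l -> {for t, continuous f}.
Proof.
move=> [df _]; apply: differentiable_continuous.
by apply/derivable1_diffP.
Qed.

Lemma is_derive_inv (z : R) : z != 0 -> is_derive z 1 (fun s : R => s^-1) (- z ^- 2).
Proof.
move=> z0; have := @is_deriveV R id z 1 1 z0 (is_derive_id _ _).
by rewrite /GRing.scale /= mulr1.
Qed.

(** For a primitive G of F = P/Q, the derivative of G(z) - G(1/z) is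
    F(z) + F(1/z) / z^2; by [integrand_landen] the derivative of
    G'(mu / (z - 1/z)) is its opposite. *)
Lemma landen_primitive x (G G' : R -> R) : denp_pos x ->
  (forall t : R, -1 < t -> is_derive t 1 G (integrand x t)) ->
  (forall t : R, -1 < t -> is_derive t 1 G' (integrand (landen x) t)) ->
  forall z1 z2 : R, 1 < z1 -> 1 < z2 ->
    G z1 - G z1^-1 + G' (Q1root x / (z1 - z1^-1)) =
    G z2 - G z2^-1 + G' (Q1root x / (z2 - z2^-1)).
Proof.
move=> xpos dG dG'; have mu0 := Q1root_gt0 xpos.
apply: (@is_derive0_cst R (fun z => G z - G z^-1 + G' (Q1root x / (z - z^-1))) 1).
move=> z z1; have z0 : 0 < z := lt_trans ltr01 z1.
have zV : 0 < z^-1 by rewrite invr_gt0.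
have zV1 : z^-1 < 1 by rewrite invf_lt1.
have u0 : 0 < z - z^-1 by rewrite subr_gt0 (lt_trans zV1).
have dV := is_derive_inv (lt0r_neq0 z0).
have d1 : is_derive z 1 G (integrand x z) by apply: dG; lra.
have d2 : is_derive z 1 (fun s => G s^-1) (integrand x z^-1 * - z ^- 2).
  by apply: (@is_derive1_comp R G (fun s => s^-1)) => //; apply: dG; lra.
have du : is_derive z 1 (fun s : R => s - s^-1) (1 + z ^- 2).
  by rewrite -[z ^- 2]opprK; apply: is_deriveB.
have dy : is_derive z 1 (fun s : R => Q1root x * (s - s^-1)^-1)
    (Q1root x * (- (z - z^-1) ^- 2 * (1 + z ^- 2))).
  apply: is_deriveZ; apply: (@is_derive1_comp R (fun s => s^-1) (fun s => s - s^-1)) => //.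
  by apply: is_derive_inv; exact: lt0r_neq0.
have y0 : 0 < Q1root x / (z - z^-1) by rewrite divr_gt0.
have d3 : is_derive z 1 (fun s => G' (Q1root x * (s - s^-1)^-1))
    (integrand (landen x) (Q1root x / (z - z^-1)) *
      (Q1root x * (- (z - z^-1) ^- 2 * (1 + z ^- 2)))).
  apply: (@is_derive1_comp R G' (fun s => Q1root x * (s - s^-1)^-1)) => //.
  by apply: dG'; lra.
apply: (is_derive_eq (is_deriveD (is_deriveB d1 d2) d3)).
rewrite integrand_landen //.
have u_neq0 := lt0r_neq0 u0.
move: (Q1root x) (lt0r_neq0 mu0) => mu mu_neq0; move: (z - z^-1) u_neq0 => u u_neq0.
have z_neq0 := lt0r_neq0 z0; have zz1 : z * z + 1 != 0 by rewrite gt_eqF //; nra.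
by field; rewrite z_neq0 mu_neq0 u_neq0 zz1.
Qed.

Lemma zsol_cvg (mu : R) : zsol (mu / y) @[y --> +oo] --> (1 : R).
Proof.
have muy : mu / y @[y --> +oo] --> (0 : R).
  rewrite -(mulr0 mu); apply: cvgM; first exact: cvg_cst.
  apply/gtr0_cvgV0; last exact: cvg_id.
  by apply: nbhs_pinfty_gt; exact: num_real.
have z0 : zsol (0 : R) = 1.
  rewrite /zsol expr0n /= !add0r (_ : 4 = 2 ^+ 2 :> R); last by ring.
  by rewrite sqrtr_sqr ger0_norm // divff.
rewrite -z0; apply: (@continuous_cvg _ _ _ _ _ _ (@zsol R) _ _ muy).
apply: cvgMl; apply: cvgD; first exact: cvg_id.
apply: (@continuous_comp _ _ _ (fun u : R => u ^+ 2 + 4) (@Num.sqrt R)).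
  apply: cvgD; last exact: cvg_cst.
  exact: exprn_continuous.
exact: sqrt_continuous.
Qed.

Lemma subrV_cvgy : z - z^-1 @[z --> +oo] --> (+oo : set_system R).
Proof.
apply/cvgryPge => A; near=> z.
have z1 : 1 <= z by near: z; apply: nbhs_pinfty_ge; exact: num_real.
have zA : A + 1 <= z by near: z; apply: nbhs_pinfty_ge; exact: num_real.
have : z^-1 <= 1 by rewrite invf_le1 // (lt_le_trans ltr01).
lra.
Unshelve. all: by end_near.
Qed.

(** As z tends to +oo, both 1/z and mu / (z - 1/z) tend to 0, so that constancy
    of the sum in [landen_primitive] makes G(z) converge. *)
Lemma landen_primitive_limit x (G G' : R -> R) (z1 : R) : denp_pos x -> G 0 = 0 -> G' 0 = 0 ->
  (forall t : R, -1 < t -> is_derive t 1 G (integrand x t)) ->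
  (forall t : R, -1 < t -> is_derive t 1 G' (integrand (landen x) t)) ->
  1 < z1 ->
  G z @[z --> +oo] --> G z1 - G z1^-1 + G' (Q1root x / (z1 - z1^-1)).
Proof.
move=> xpos G0 G'0 dG dG' z1_gt1; set c := G z1 - _ + _.
have invy : z^-1 @[z --> +oo] --> (0 : R).
  apply/gtr0_cvgV0; last exact: cvg_id.
  by apply: nbhs_pinfty_gt; exact: num_real.
have Hc : c + G z^-1 - G' (Q1root x / (z - z^-1)) @[z --> +oo] --> c.
  rewrite [X in _ --> X](_ : c = c + G 0 - G' 0); last by rewrite G0 G'0 subr0 addr0.
  apply: cvgB; first apply: cvgD; first exact: cvg_cst.
    apply: (@continuous_cvg _ _ _ _ _ _ G _ _ invy).
    by apply: is_derive_continuous (dG 0 _); rewrite ltrN10.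
  apply: (@continuous_cvg _ _ _ _ _ _ G').
    by apply: is_derive_continuous (dG' 0 _); rewrite ltrN10.
  rewrite -(mulr0 (Q1root x)); apply: cvgM; first exact: cvg_cst.
  apply/gtr0_cvgV0; last exact: subrV_cvgy.
  near=> z; have zgt1 : 1 < z by near: z; apply: nbhs_pinfty_gt; exact: num_real.
  by rewrite subr_gt0 (lt_trans _ zgt1) // invf_lt1 // (lt_trans ltr01).
apply: cvg_trans Hc; apply: near_eq_cvg; near=> z.
have zgt1 : 1 < z by near: z; apply: nbhs_pinfty_gt; exact: num_real.
by rewrite /c (landen_primitive xpos dG dG' z1_gt1 zgt1); ring.
Unshelve. all: by end_near.
Qed.

Lemma partial_integral_cvg x : denp_pos x -> cvg (partial_integral x @ +oo).
Proof.
move=> xpos; have [G [G0 dG xG]] := partial_integral_primitive xpos.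
have [G' [G'0 dG' _]] := partial_integral_primitive (denp_pos_landen hp xpos).
have z1 : 1 < 2 :> R by rewrite ltr1n.
apply/cvg_ex; exists (G 2 - G 2^-1 + G' (Q1root x / (2 - 2^-1))).
rewrite (partial_integral_cvgE _ xG); exact: (landen_primitive_limit xpos G0 G'0 dG dG' z1).
Qed.

(** The sum in [landen_primitive] tends to the integral of P/Q as z tends to
    +oo, and to that of P^+/Q^+ as z tends to 1, where mu / (z - 1/z) tends to
    +oo. *)
Lemma landen_integral x (l : R) : denp_pos x ->
  partial_integral x @ +oo --> l -> partial_integral (landen x) @ +oo --> l.
Proof.
move=> xpos; have ypos := denp_pos_landen hp xpos.
have [G [G0 dG xG]] := partial_integral_primitive xpos.
have [G' [G'0 dG' yG']] := partial_integral_primitive ypos.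
rewrite (partial_integral_cvgE _ xG) (partial_integral_cvgE _ yG') => Gl.
have mu0 := Q1root_gt0 xpos.
have contG t : -1 < t -> {for t, continuous G} by move=> /dG; exact: is_derive_continuous.
have Hc z : 1 < z -> G z - G z^-1 + G' (Q1root x / (z - z^-1)) = l.
  move=> z1; apply: (cvg_unique _ _ Gl) => //.
  exact: (landen_primitive_limit xpos G0 G'0 dG dG' z1).
have zs := zsol_cvg (Q1root x).
have : l - (G (zsol (Q1root x / y)) - G (zsol (Q1root x / y))^-1) @[y --> +oo] --> l.
  rewrite [X in _ --> X](_ : l = l - (G 1 - G 1^-1)); last by rewrite invr1 subrr subr0.
  apply: cvgB; first exact: cvg_cst.
  apply: cvgB; first by apply: (@continuous_cvg _ _ _ _ _ _ G _ _ zs); apply: contG; lra.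
  apply: (@continuous_cvg _ _ _ _ _ _ G); first by apply: contG; rewrite invr1; lra.
  by apply: cvgV zs.
apply: cvg_trans; apply: near_eq_cvg; near=> y.
have y0 : 0 < y by near: y; apply: nbhs_pinfty_gt; exact: num_real.
have [z1 uz] := zsolP (divr_gt0 mu0 y0).
rewrite -(Hc _ z1) addrAC subrr add0r uz; congr G'.
by rewrite invf_div mulrCA mulfV ?mulr1 // lt0r_neq0.
Unshelve. all: by end_near.
Qed.

End Invariance.

(** * The transformation on numerators *)

Section Numerator.
Variables (R : realType) (p : nat).
Hypothesis hp : (1 <= p)%N.
Implicit Types (x : params R p) (b : 'rV[R]_p).

(** For fixed a, the transformation is linear in b. *)
Definition landen_mx x : 'M[R]_p :=
  \matrix_(j, i) bplus ((x.1, delta_mx 0 j) : params R p) i.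

Lemma bcoef_at x (m : nat) (mp : (m < p)%N) : bcoef x m%:Z = x.2 0 (Ordinal mp).
Proof. exact: (bcoef_in x (Ordinal mp)). Qed.

Lemma bcoef_linear x (m : int) :
  bcoef x m = \sum_j x.2 0 j * bcoef ((x.1, delta_mx 0 j) : params R p) m.
Proof.
have [m0|] := ltP m 0.
  by rewrite bcoef_neg // big1 // => j _; rewrite bcoef_neg // mulr0.
case: m => // m _; have [mp|pm] := ltnP m p; last first.
  by rewrite bcoef_out // big1 // => j _; rewrite bcoef_out ?mulr0.
rewrite bcoef_at (bigD1 (Ordinal mp)) // [X in _ = _ + X]big1 ?addr0.
  by rewrite bcoef_at mxE !eqxx /= mulr1.
by move=> j jm; rewrite bcoef_at mxE eqxx eq_sym (negbTE jm) /= mulr0.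
Qed.

Lemma ccoef_linear x k :
  ccoef x k = \sum_j x.2 0 j * ccoef ((x.1, delta_mx 0 j) : params R p) k.
Proof.
rewrite /ccoef; under eq_bigr do rewrite bcoef_linear mulr_sumr.
rewrite exchange_big /=; apply: eq_bigr => j _; rewrite mulr_sumr.
by apply: eq_bigr => l _; rewrite mulrCA.
Qed.

Lemma landen2E x : (landen x).2 = x.2 *m landen_mx x.
Proof.
apply/rowP => i; rewrite !mxE /bplus mulr_sumr.
under [RHS]eq_bigr do rewrite mxE /bplus mulrCA mulr_sumr mulr_sumr.
rewrite exchange_big /=; apply: eq_bigr => k _.
rewrite [ccoef x k]ccoef_linear [ccoef x (2 * p - 1 - k)]ccoef_linear.
rewrite -big_split /= mulr_suml mulr_sumr; apply: eq_bigr => j _.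
by rewrite -/(Q1 x) -mulrDr -mulrA.
Qed.

Lemma numpE x (i : 'I_p) : (nump x)`_(p - 1 - i) = x.2 0 i.
Proof.
have ip := ltn_ord i.
rewrite coef_poly ifT; last by lia.
by rewrite -bcoef_in; congr (bcoef x (Posz _)); lia.
Qed.

(** The denominator is (1 + z^2)^p, a fixed point of Q |-> Q^+, and mu = 2. *)
Definition at_limit b : params R p := ((landen_limit p (0 : R)).1, b).

Lemma acoef_limit b k : acoef (at_limit b) k%:Z = 'C(p, k)%:R.
Proof.
case: k => [|k]; first by rewrite acoef0 bin0.
have [->|kp] := eqVneq k.+1 p; first by rewrite acoefp binn.
have [ltkp|lepk] := ltnP k p.-1.
  by rewrite (acoef_in hp _ (Ordinal ltkp)) mxE.
by rewrite acoef_out ?bin_small //; lia.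
Qed.

Lemma denp_limit b : denp (at_limit b) = ('X + 1) ^+ p.
Proof.
apply/polyP => k; rewrite coef_X1_exp coef_poly; case: ltnP => [kp|pk].
  by rewrite acoef_limit bin_sub.
by rewrite bin_small.
Qed.

Lemma horner_denp_limit b y : (denp (at_limit b)).[y] = (1 + y) ^+ p.
Proof. by rewrite denp_limit horner_exp hornerD hornerX hornerC addrC. Qed.

Lemma denp_pos_limit b : denp_pos (at_limit b).
Proof. by move=> y y0; rewrite horner_denp_limit exprn_gt0 // ltr_wpDr. Qed.

Lemma Q1root_limit b : Q1root (at_limit b) = 2.
Proof.
rewrite /Q1root /Q1 Qpoly_denp expr1n horner_denp_limit.
have p20 : 0 < (1 + 1 : R) ^+ p by rewrite exprn_gt0 // ltr_wpDr.
rewrite gtr0_sg // mul1r gtr0_norm // -powR_mulrn ?addr_ge0 //.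
by rewrite -powRrM mulfV ?powRr1 ?addr_ge0 // pnatr_eq0 -lt0n.
Qed.

(** With z = tan theta, (1 - z^2) / (1 + z^2) = cos (2 theta), and
    P(z) / (1 + z^2)^(p-1) is a polynomial in it; k bounds its size. *)
Definition cos_degree k b : Prop := exists2 g : {poly R}, (size g <= k)%N &
  forall y : R, 0 < y ->
    (nump (at_limit b)).[y] = (1 + y) ^+ (p - 1) * g.[(1 - y) / (1 + y)].

Lemma cos_degree_p b : cos_degree p b.
Proof.
(* h (-1) and h 1 take the values y / (1 + y) and 1 / (1 + y) *)
pose h (s : R) : {poly R} := 2^-1 *: (1 + s *: 'X).
have hsize s : (size (h s) <= 2)%N.
  apply: leq_trans (size_scale_leq _ _) _; apply: leq_trans (size_polyD _ _) _.
  rewrite geq_max size_poly1 /=; apply: leq_trans (size_scale_leq _ _) _.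
  by rewrite size_polyX.
have hexp s k : (size (h s ^+ k) <= k.+1)%N.
  apply: leq_trans (size_poly_exp_leq _ _) _; have := hsize s.
  by case: (size _) => [|[|[|]]] //= _; lia.
exists (\sum_(k < p) bcoef (at_limit b) (p - 1 - k)%N%:Z *: (h (-1) ^+ k * h 1 ^+ (p - 1 - k))).
  apply: leq_trans (size_sum _ _ _) _; apply/bigmax_leqP => k _.
  apply: leq_trans (size_scale_leq _ _) _; apply: leq_trans (size_polyMleq _ _) _.
  have := hexp (-1) k; have := hexp 1 (p - 1 - k)%N; have := ltn_ord k; lia.
move=> y y0; have y1 : 1 + y != 0 by rewrite gt_eqF // ltr_pwDr // ltW.
rewrite nump_sum big_mkord horner_sum mulr_sumr; apply: eq_bigr => k _.
have kp := ltn_ord k.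
rewrite hornerZ hornerM !horner_exp /h !(hornerZ, hornerD, hornerX, hornerC) mulrCA.
congr (_ * _).
have -> : 2^-1 * (1 + -1 * ((1 - y) / (1 + y))) = y / (1 + y) by field.
have -> : 2^-1 * (1 + 1 * ((1 - y) / (1 + y))) = (1 + y)^-1 by field.
rewrite (_ : p - 1 = k + (p - 1 - k))%N; last by lia.
rewrite (_ : k + (p - 1 - k) - k = p - 1 - k)%N; last by lia.
rewrite exprD expr_div_n exprVn mulrACA mulfV ?mulr1 ?expf_neq0 //.
by rewrite mulrCA mulfV ?mulr1 // expf_neq0.
Qed.

Lemma even_polyE (g : {poly R}) (s : R) :
  g.[s] + g.[- s] = 2 * (even_poly g).[s ^+ 2].
Proof.
have gE t : g.[t] = (even_poly g).[t ^+ 2] + (odd_poly g).[t ^+ 2] * t.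
  by rewrite -{1}[g]poly_even_odd hornerD hornerM hornerX !horner_comp hornerXn.
rewrite !gE sqrrN; ring.
Qed.

(** For mu = 2 the map z |-> 2 / (z - 1/z) sends tan theta to - tan (2 theta),
    and the preimages z and -1/z have opposite values xi and - xi of
    cos (2 theta). The new polynomial takes the value (g(xi) + g(-xi)) / 2 at
    cos (4 theta) = 2 xi^2 - 1, so that only the even part of g contributes and
    the degree is halved. *)
Lemma cos_degree_landen k b : cos_degree k b ->
  cos_degree (uphalf k) (b *m landen_mx (at_limit b)).
Proof.
move=> [g gk gE].
exists (even_poly g \Po (2^-1 *: (1 + 'X))).
  apply: leq_trans (_ : size (even_poly g) <= _)%N; last first.
    by apply: leq_trans (size_even_poly _) _; exact: uphalf_leq.
  by rewrite size_comp_poly2 // size_scale ?invr_eq0 ?pnatr_eq0 // addrC size_XaddC.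
move=> y y0; have y1 : 1 + y != 0 by rewrite gt_eqF // ltr_pwDr // ltW.
have y20 : 0 < Num.sqrt y by rewrite sqrtr_gt0.
have -> : (nump (at_limit (b *m landen_mx (at_limit b)))).[y] = (nump (landen (at_limit b))).[y].
  rewrite !nump_sum; apply: eq_bigr => k' _; congr (_ * _).
  by rewrite /bcoef -/(landen_mx _) landen2E.
have [z z1 uz] := landen_preimage (ltr0n R 2) y20.
have z_gt0 : 0 < z := lt_trans ltr01 z1; have z0 := lt0r_neq0 z_gt0.
have z2 : z ^+ 2 != 1 by rewrite gt_eqF // expr2; nra.
have yE : y = 2 ^+ 2 / (z - z^-1) ^+ 2.
  by rewrite uz expr_div_n sqr_sqrtr ?ltW //; field; rewrite lt0r_neq0.
have := nump_landen hp (denp_pos_defined (@denp_pos_limit b)) z0 z2.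
rewrite Q1root_limit -yE => ->.
have zz0 : 0 < z ^+ 2 by rewrite exprn_gt0.
rewrite !gE ?invr_gt0 // !horner_denp_limit horner_comp.
have zz1 : 1 + z ^+ 2 != 0 by rewrite gt_eqF // addr_gt0.
have u0 : z - z^-1 != 0 by rewrite uz gt_eqF // divr_gt0.
have zm1 : z ^+ 2 - 1 != 0 by rewrite subr_eq0.
have -> : (1 - z ^- 2) / (1 + z ^- 2) = - ((1 - z ^+ 2) / (1 + z ^+ 2)).
  by field; rewrite zz1 z0.
set xi := (1 - z ^+ 2) / (1 + z ^+ 2).
have -> : (2^-1 *: (1 + 'X)).[(1 - y) / (1 + y)] = xi ^+ 2.
  rewrite hornerZ hornerD hornerC hornerX yE /xi; field.
  rewrite zz1 z0 -expr2 zm1 /= gt_eqF // ltr_wpDl ?sqr_ge0 //.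
  by rewrite mulr_gt0.
have -> : (even_poly g).[xi ^+ 2] = (g.[xi] + g.[- xi]) / 2.
  by rewrite even_polyE mulrC mulKf // pnatr_eq0.
have -> : 1 + y = (1 + z ^+ 2) * (1 + z ^- 2) / (z - z^-1) ^+ 2.
  by rewrite yE; field; rewrite z0 -expr2.
have pS (a : R) : a ^+ p = a * a ^+ (p - 1).
  by rewrite -exprS; congr (_ ^+ _); lia.
rewrite !pS exprM expr_div_n [((1 + _) * _) ^+ _]exprMn.
have := expf_neq0 (p - 1) (expf_neq0 2 u0).
move: (((z - z^-1) ^+ 2) ^+ _) ((1 + z ^+ 2) ^+ _) ((1 + z ^- 2) ^+ _) => w c d w0.
by field; rewrite w0 z0 -expr2 addrC.
Qed.

(** A constant in cos (2 theta) is a multiple of (1 + z^2)^(p-1). *)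
Lemma cos_degree1 b : cos_degree 1 b ->
  exists k : R, forall i : 'I_p, b 0 i = k * 'C(p.-1, i)%:R.
Proof.
move=> [g /size1_polyC -> gE]; exists g`_0 => i.
rewrite -[b]/((at_limit b).2) -numpE.
have -> : nump (at_limit b) = g`_0 *: ('X + 1) ^+ (p - 1).
  apply: poly_eq_on_nat => n; rewrite gE ?ltr0n // hornerC hornerZ mulrC.
  by rewrite horner_exp hornerD hornerX hornerC addrC.
have ip := ltn_ord i.
by rewrite coefZ coef_X1_exp -subn1 bin_sub //; lia.
Qed.

Fixpoint prod_mx (A : nat -> 'M[R]_p) n m : 'M[R]_p :=
  if m is m'.+1 then prod_mx A n m' *m A (n + m')%N else 1%:M.

Definition limit_mx : 'M[R]_p := landen_mx (at_limit 0).

(** After p halvings of the degree only constants are left. *)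
Lemma limit_mx_rank1 : exists k : 'I_p -> R, forall j i,
  prod_mx (fun=> limit_mx) 0 p j i = k j * 'C(p.-1, i)%:R.
Proof.
have deg m b : cos_degree (maxn 1 (p - m)) (b *m prod_mx (fun=> limit_mx) 0 m).
  elim: m => [|m [g gs gE]] /=.
    have [g gs gE] := cos_degree_p b.
    by rewrite mulmx1; exists g => //; rewrite leq_max subn0 gs orbT.
  have [h hs hE] := cos_degree_landen (ex_intro2 _ _ g gs gE).
  rewrite mulmxA; exists h => //; apply: leq_trans hs _.
  by rewrite uphalfE; lia.
have row1 j : exists k : R, forall i : 'I_p,
    (prod_mx (fun=> limit_mx) 0 p) j i = k * 'C(p.-1, i)%:R.
  have := deg p (delta_mx 0 j); rewrite subnn maxn0 => /cos_degree1[k kE].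
  by exists k => i; rewrite -kE -rowE mxE.
by have [k kE] := choice row1; exists k.
Qed.

Lemma cvg_prod_mx (A : nat -> 'M[R]_p) (B : 'M[R]_p) m :
  (forall i j, A n i j @[n --> \oo] --> B i j) ->
  forall i j, prod_mx A n m i j @[n --> \oo] --> prod_mx (fun=> B) 0 m i j.
Proof.
move=> AB; elim: m => [|m IH] i j /=; first exact: cvg_cst.
under [X in X @ _ --> _]funext do rewrite mxE.
rewrite mxE; apply: cvg_sumr => k; apply: cvgM; first exact: IH.
exact: (cvg_comp _ _ (cvg_addnr m) (AB k j)).
Qed.

Lemma prod_mxE x n m : (landen_iter x (n + m)).2 =
  (landen_iter x n).2 *m prod_mx (fun n => landen_mx (landen_iter x n)) n m.
Proof.
elim: m => [|m IH]; first by rewrite addn0 mulmx1.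
by rewrite addnS [LHS]landen2E IH mulmxA.
Qed.

End Numerator.

(** * Estimates near the limit *)

Section Limits.
Variables (R : realType) (p : nat).
Hypothesis hp : (1 <= p)%N.
Implicit Types (x : params R p).

Lemma acoef_cvg x k : denp_pos x ->
  acoef (landen_iter x n) k%:Z @[n --> \oo] --> ('C(p, k)%:R : R).
Proof.
move=> xpos; have [pk|kp] := ltnP p k.
  rewrite bin_small //; under [X in X @ _ --> _]funext do rewrite acoef_out //.
  exact: cvg_cst.
rewrite -bin_sub //.
have -> : (fun n => acoef (landen_iter x n) k%:Z) =
    (fun n => (denp (landen_iter x n))`_(p - k)).
  by apply/funext => n; rewrite coef_poly ltnS leq_subr subKn.
exact: denp_cvg.
Qed.

Lemma exprz_cvg (u : nat -> R) (l : R) (m : int) : l != 0 ->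
  u n @[n --> \oo] --> l -> u n ^ m @[n --> \oo] --> l ^ m.
Proof.
move=> l0 ul.
have cvgX k : u n ^+ k @[n --> \oo] --> l ^+ k.
  elim: k => [|k IH]; first exact: cvg_cst.
  rewrite exprS; under [X in X @ _ --> _]funext do rewrite exprS.
  exact: cvgM.
case: m => k; first exact: cvgX.
rewrite NegzE -exprnN; under [X in X @ _ --> _]funext do rewrite -exprnN.
by apply: cvgV; [rewrite expf_neq0|exact: cvgX].
Qed.

Lemma Q1E x : Q1 x = \sum_(0 <= k < p.+1) acoef x (p - k)%N%:Z.
Proof.
rewrite /Q1 Qpoly_denp expr1n denp_sum.
by apply: eq_bigr => k _; rewrite expr1n mulr1.
Qed.

Lemma Q1root_cvg x : denp_pos x ->
  Q1root (landen_iter x n) @[n --> \oo] --> Q1root (at_limit (0 : 'rV[R]_p)).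
Proof.
move=> xpos.
have Q1gt0 y : denp_pos y -> 0 < Q1 y by move=> h; rewrite /Q1 Qpoly_denp expr1n h.
have Q1rootE (y : params R p) : denp_pos y -> Q1root y = expR (p%:R^-1 * ln (Q1 y)).
  move=> /Q1gt0 y0; rewrite /Q1root gtr0_sg // mul1r gtr0_norm //.
  by rewrite /powR gt_eqF.
have lpos := @denp_pos_limit _ _ hp (0 : 'rV[R]_p).
rewrite Q1rootE //.
have -> : (fun n => Q1root (landen_iter x n)) =
    (fun n => expR (p%:R^-1 * ln (Q1 (landen_iter x n)))).
  by apply/funext => n; rewrite Q1rootE //; exact: denp_pos_iter.
apply: continuous_cvg; first exact: continuous_expR.
apply: cvgM; first exact: cvg_cst.
apply: continuous_cvg; first by apply: continuous_ln; exact: Q1gt0.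
rewrite Q1E; under [X in X @ _ --> _]funext do rewrite Q1E.
by apply: cvg_sumr => k; rewrite acoef_limit //; exact: acoef_cvg.
Qed.

Lemma landen_mx_cvg x i j : denp_pos x ->
  landen_mx (landen_iter x n) i j @[n --> \oo] --> limit_mx R p i j.
Proof.
move=> xpos; rewrite /limit_mx mxE; under [X in X @ _ --> _]funext do rewrite mxE.
have ccvg k : ccoef (((landen_iter x n).1, delta_mx 0 i) : params R p) k @[n --> \oo] -->
    ccoef (((at_limit (0 : 'rV[R]_p)).1, delta_mx 0 i) : params R p) k.
  rewrite /ccoef; apply: cvg_sumr => l; apply: cvgM; last first.
    by rewrite /bcoef; case: (p%:Z - 1 - _ + _) => m /=; exact: cvg_cst.
  have -> : acoef (((at_limit (0 : 'rV[R]_p)).1, delta_mx 0 i) : params R p) l%:Z = 'C(p, l)%:R.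
    exact: (acoef_limit hp (delta_mx 0 i)).
  exact: acoef_cvg.
rewrite /bplus; apply: cvgM.
  apply: (@exprz_cvg (fun n => Q1root (landen_iter x n))
    (Q1root (at_limit (0 : 'rV[R]_p)))); last exact: Q1root_cvg.
  by rewrite Q1root_limit // pnatr_eq0.
apply: cvg_sumr => k; apply: cvgM; last exact: cvg_cst.
by apply: cvgD; exact: ccvg.
Qed.

(** All binomial coefficients are at least 1, so an error e in each coefficient
    is at most e (1 + y)^n in the value. *)
Lemma binomial_estimate (n : nat) (c : nat -> R) (k e y : R) : 0 <= y -> 0 <= e ->
  (forall i, (i <= n)%N -> `|c i - k * 'C(n, i)%:R| <= e) ->
  `|\sum_(0 <= i < n.+1) c i * y ^+ i - k * (1 + y) ^+ n| <= e * (1 + y) ^+ n.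
Proof.
move=> y0 e0 ce.
have -> : (1 + y) ^+ n = \sum_(0 <= i < n.+1) 'C(n, i)%:R * y ^+ i.
  rewrite big_mkord exprDn; apply: eq_bigr => i _.
  by rewrite expr1n mul1r mulr_natl.
rewrite !mulr_sumr -sumrB (le_trans (ler_norm_sum _ _ _)) //.
rewrite big_nat_cond [leRHS]big_nat_cond.
apply: ler_sum => i /andP[/andP[_ ilen] _].
rewrite !mulrA -mulrBl normrM normrX (ger0_norm y0).
rewrite ler_wpM2r ?exprn_ge0 // (le_trans (ce _ ilen)) // ler_peMr //.
by rewrite ler1n bin_gt0.
Qed.

(** Near the limit, P is close to k (1 + t^2)^(p-1) and Q to (1 + t^2)^p, with
    Q at least half of the latter. *)
Lemma integrand_estimate x (k eta dlt t : R) : denp_pos x -> 0 <= eta <= 2^-1 ->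
  (forall j, (j <= p)%N -> `|acoef x j%:Z - 'C(p, j)%:R| <= eta) ->
  (forall i : 'I_p, `|x.2 0 i - k * 'C(p.-1, i)%:R| <= dlt) ->
  `|integrand x t - k / (1 + t ^+ 2)| <= 2 * (dlt + `|k| * eta) / (1 + t ^+ 2).
Proof.
move=> xpos /andP[eta0 eta2] xa xb; rewrite integrandE //.
have y0 := sqr_ge0 t; move: (t ^+ 2) y0 => y y0.
have dlt0 : 0 <= dlt := le_trans (normr_ge0 _) (xb (Ordinal hp)).
have dE : `|(denp x).[y] - 1 * (1 + y) ^+ p| <= eta * (1 + y) ^+ p.
  rewrite denp_sum; apply: binomial_estimate => // i ip.
  by rewrite mul1r -bin_sub //; apply: xa; exact: leq_subr.
have nE : `|(nump x).[y] - k * (1 + y) ^+ p.-1| <= dlt * (1 + y) ^+ p.-1.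
  have := @binomial_estimate p.-1 (fun i => bcoef x (p - 1 - i)%N%:Z) k dlt y y0 dlt0.
  rewrite nump_sum prednK //; apply=> i ip.
  have ltip : (p - 1 - i < p)%N by lia.
  have iE : (p.-1 - i)%N = Ordinal ltip by rewrite /= subn1.
  by rewrite (bcoef_at _ ltip) -bin_sub // iE.
have w0 : 0 < 1 + y by lra.
have wn0 : 0 < (1 + y) ^+ p.-1 by rewrite exprn_gt0.
move: dE nE; rewrite mul1r -{2 3}(prednK hp) exprS.
have := xpos _ y0; move: (1 + y) w0 => w w0; move: (w ^+ _) wn0 => v v0.
move: (denp x).[_] (nump x).[_] => Q P Q0 dE nE.
have Qlow : 2^-1 * (w * v) <= Q by move: dE => /ler_normlP[+ _]; nra.
have -> : P / Q - k / w = (P - k * v - k * (Q - w * v) / w) / Q.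
  by field; rewrite !lt0r_neq0.
rewrite normrM normfV (gtr0_norm Q0) ler_pdivrMr //.
have h : `|P - k * v - k * (Q - w * v) / w| <= (dlt + `|k| * eta) * v.
  apply: le_trans (ler_normB _ _) _; rewrite mulrDl lerD // normrM normfV (gtr0_norm w0).
  rewrite ler_pdivrMr // normrM; apply: le_trans (ler_wpM2l (normr_ge0 k) dE) _.
  by rewrite [w * v]mulrC !mulrA.
apply: le_trans h _.
have c0 : 0 <= dlt + `|k| * eta by rewrite addr_ge0 // mulr_ge0.
have h2 : v <= 2 * Q / w by rewrite ler_pdivlMr //; lra.
apply: le_trans (ler_wpM2l c0 h2) _; rewrite le_eqVlt; apply/orP; left; apply/eqP.
by field; rewrite lt0r_neq0.
Qed.

(** The integral of k / (1 + t^2) is k pi / 2, so the invariant integral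
    determines k up to small errors. *)
Lemma integral_estimate x (l k eta dlt : R) : denp_pos x -> 0 <= eta <= 2^-1 ->
  (forall j, (j <= p)%N -> `|acoef x j%:Z - 'C(p, j)%:R| <= eta) ->
  (forall i : 'I_p, `|x.2 0 i - k * 'C(p.-1, i)%:R| <= dlt) ->
  partial_integral x @ +oo --> l ->
  `|2 / pi * l - k| <= 2 * (dlt + `|k| * eta).
Proof.
move=> xpos etab xa xb; have [G [G0 dG xG]] := partial_integral_primitive xpos.
rewrite (partial_integral_cvgE _ xG) => Gl.
set M := 2 * (dlt + `|k| * eta).
pose K t := G t - k * atan t.
have K0 : K 0 = 0 by rewrite /K G0 atan0 mulr0 subr0.
have dK (t : R) : 0 <= t -> is_derive t 1 K (integrand x t - k * (1 + t ^+ 2)^-1).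
  move=> t0; have t1 : -1 < t by lra.
  by have := dG t t1 => ?; apply: is_deriveB; exact: is_deriveZ.
have KM := primitive_bound K0 dK (fun t _ => integrand_estimate t xpos etab xa xb).
have Kl : K t @[t --> +oo] --> l - k * (pi / 2).
  by apply: cvgB => //; apply: cvgM; [exact: cvg_cst|exact: cvgy_atan].
have pi0 := pi_gt0 R.
have : `|l - k * (pi / 2)| <= M * (pi / 2).
  apply: (cvgr_to_le (cvg_norm Kl)); near=> t; apply: KM.
  by near: t; apply: nbhs_pinfty_ge; exact: num_real.
move: (pi : R) pi0 (lt0r_neq0 pi0) => q q0 q_neq0.
have -> : 2 / q * l - k = (l - k * (q / 2)) * (2 / q) by field.
have c0 : 0 < 2 / q by rewrite divr_gt0.
by rewrite normrM (gtr0_norm c0) -ler_pdivlMr // invf_div.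
Unshelve. all: by end_near.
Qed.

(** The bound 2 |A| plus the first p values reproduces itself every p steps. *)
Lemma bounded_of_contraction (S : nat -> R) (A : R) (N : nat) : (forall n, 0 <= S n) ->
  (forall n, (N <= n)%N -> S (n + p)%N <= A + S n / 2) ->
  exists B, forall n, (N <= n)%N -> S n <= B.
Proof.
move=> S0 SA; exists (2 * `|A| + \sum_(i < p) S (N + i)%N) => n.
have sum0 : 0 <= \sum_(i < p) S (N + i)%N by apply: sumr_ge0 => i _.
elim/ltn_ind: n => n IH Nn; have [nNp|Npn] := ltnP n (N + p).
  have ip : (n - N < p)%N by lia.
  rewrite (bigD1 (Ordinal ip)) //= subnKC // addrCA lerDl addr_ge0 ?mulr_ge0 //.
  by apply: sumr_ge0 => i _.
have Nnp : (N <= n - p)%N by lia.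
have := SA _ Nnp; rewrite subnK; last by lia.
have ltn : (n - p < n)%N by lia.
have := IH _ ltn Nnp; have := ler_norm A; lra.
Qed.

End Limits.

(** * Convergence of the numerators *)

Section NumeratorLimit.
Variables (R : realType) (p : nat).
Hypothesis hp : (1 <= p)%N.
Implicit Types (x : params R p).

Definition numer_size x (n : nat) : R := \sum_j `|(landen_iter x n).2 0 j|.

Lemma partial_integral_iter x (l : R) n : denp_pos x ->
  partial_integral x @ +oo --> l -> partial_integral (landen_iter x n) @ +oo --> l.
Proof.
move=> xpos xl; elim: n => // n IH; apply: landen_integral => //.
exact: denp_pos_iter.
Qed.

(** The product of p consecutive matrices is close to one of rank one, so after
    p steps the numerator is nearly k (1 + z^2)^(p-1), with an error small
    compared with the numerator p steps before; [integral_estimate] bounds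
    the distance of k to 2 l / pi. *)
Lemma numer_step x (l e : R) : denp_pos x -> partial_integral x @ +oo --> l ->
  0 < e <= 2^-1 -> \forall n \near \oo, exists k : R,
    (forall i : 'I_p, `|(landen_iter x (n + p)).2 0 i - k * 'C(p.-1, i)%:R|
       <= e * numer_size x n) /\
    `|2 / pi * l - k| <= 2 * (e * numer_size x n + `|k| * e).
Proof.
move=> xpos xl /andP[e0 e2]; have [k limE] := limit_mx_rank1 R hp.
have Mcvg := @cvg_prod_mx _ _ _ _ p (fun i j => @landen_mx_cvg _ _ hp x i j xpos).
have nearM : \forall n \near \oo, forall ij : 'I_p * 'I_p,
    `|prod_mx (fun m => landen_mx (landen_iter x m)) n p ij.1 ij.2 - k ij.1 * 'C(p.-1, ij.2)%:R| <= e.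
  apply: filter_forall => -[i j] /=; have := Mcvg i j; rewrite limE.
  by move/cvgrPdist_le => /(_ e e0); apply: filterS => n; rewrite distrC.
have neara : \forall n \near \oo, forall j : 'I_p.+1,
    `|acoef (landen_iter x (n + p)) j%:Z - 'C(p, j)%:R| <= e.
  apply: filter_forall => j; have := @acoef_cvg _ _ hp x j xpos.
  move=> /(cvg_comp _ _ (cvg_addnr p))/cvgrPdist_le => /(_ e e0).
  by apply: filterS => n; rewrite distrC.
near=> n; exists (\sum_j (landen_iter x n).2 0 j * k j).
have step i : `|(landen_iter x (n + p)).2 0 i -
    (\sum_j (landen_iter x n).2 0 j * k j) * 'C(p.-1, i)%:R| <= e * numer_size x n.
  rewrite prod_mxE // mxE mulr_suml -sumrB mulr_sumr.
  apply: le_trans (ler_norm_sum _ _ _) _; apply: ler_sum => j _.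
  rewrite -mulrA -mulrBr normrM mulrC ler_wpM2r //.
  by have := near nearM n; move=> /(_ _ (j, i)) /=; apply.
split=> //; apply: (@integral_estimate _ _ hp (landen_iter x (n + p))) step _.
- exact: denp_pos_iter.
- by rewrite (ltW e0).
- by move=> j jp; have := near neara n; move=> /(_ _ (Ordinal (jp : (j < p.+1)%N))); apply.
- exact: partial_integral_iter.
Unshelve. all: by end_near.
Qed.

(** A fixed small e in [numer_step] shows that the numerators are bounded; then
    e can be made arbitrarily small, and the errors tend to 0. *)
Lemma numer_cvg x (l : R) i : denp_pos x -> partial_integral x @ +oo --> l ->
  (landen_iter x n).2 0 i @[n --> \oo] --> 'C(p.-1, i)%:R * (2 / pi * l).
Proof.
move=> xpos xl; pose lam := 2 / pi * l; rewrite -/lam mulrC.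
pose c : R := \sum_(i < p) 'C(p.-1, i)%:R.
have c0 : 0 <= c by apply: sumr_ge0 => j _; rewrite ler0n.
have p1 : 1 <= p%:R :> R by rewrite ler1n.
(* small enough for the size after p steps to be at most a constant plus half
   of the size before *)
pose e0 : R := (4 * (4 * c + p%:R))^-1.
have d0 : 0 < 4 * (4 * c + p%:R) by lra.
have e0_gt0 : 0 < e0 by rewrite invr_gt0.
have e0_le4 : e0 <= 4^-1 by rewrite lef_pV2 ?posrE //; lra.
have e0c : e0 * (4 * c + p%:R) = 4^-1.
  by rewrite /e0 invfM -mulrA mulVf ?mulr1 // lt0r_neq0 //; lra.
have S0 n : 0 <= numer_size x n by apply: sumr_ge0.
have bound_k e k S : 0 < e <= 4^-1 -> 0 <= S ->
    `|lam - k| <= 2 * (e * S + `|k| * e) -> `|k| <= 2 * `|lam| + 4 * (e * S).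
  move=> /andP[e_gt0 e4] S_ge0 h.
  have : `|k| <= `|lam| + `|lam - k|.
    by rewrite -{1}(subKr lam k) (le_trans (ler_normB _ _)).
  have := ler_wpM2l (normr_ge0 k) e4; lra.
have e0b : 0 < e0 <= 2^-1 by rewrite e0_gt0 (le_trans e0_le4) // lef_pV2 ?posrE //; lra.
have [N _ stepN] := numer_step xpos xl e0b.
have Srec n : (N <= n)%N ->
    numer_size x (n + p) <= 2 * `|lam| * c + numer_size x n / 2.
  move=> /stepN[k [bk lamk]].
  have kb := bound_k e0 k _ (_ : 0 < e0 <= 4^-1) (S0 n) lamk.
  rewrite e0_gt0 e0_le4 in kb; have {}kb := kb isT.
  have h : numer_size x (n + p) <= \sum_(i < p) (`|k| * 'C(p.-1, i)%:R + e0 * numer_size x n).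
    apply: ler_sum => j _; have := bk j.
    rewrite -[X in _ -> `|X| <= _](subrK (k * 'C(p.-1, j)%:R)) => bkj.
    apply: le_trans (ler_normD _ _) _; rewrite addrC lerD //.
    by rewrite normrM [X in _ * X]ger0_norm.
  apply: le_trans h _.
  rewrite big_split /= -mulr_sumr -/c sumr_const card_ord -[_ *+ p]mulr_natr.
  have := ler_wpM2r c0 kb; have := S0 n; move: (numer_size x n) => S S_ge0 kc.
  have : e0 * (4 * c + p%:R) * S = 4^-1 * S by rewrite e0c.
  lra.
have [B SB] := bounded_of_contraction hp S0 Srec.
have B0 : 0 <= B := le_trans (S0 N) (SB N (leqnn N)).
pose C : R := 'C(p.-1, i)%:R; rewrite -/C; have C0 : 0 <= C by rewrite ler0n.
pose T := B + 2 * C * (2 * B + 2 * `|lam|).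
have T0 : 0 <= T by rewrite /T; have := normr_ge0 lam; nra.
rewrite -(cvg_shiftn p); apply/cvgrPdist_le => eps eps0.
pose e := Num.min 4^-1 (eps / (T + 1)).
have e_gt0 : 0 < e by rewrite lt_min invr_gt0 ltr0n divr_gt0 //; lra.
have e4 : e <= 4^-1 by rewrite ge_min lexx.
have eT : e * T <= eps.
  have : e * (T + 1) <= eps by rewrite -ler_pdivlMr ?ge_min ?lexx ?orbT //; lra.
  by rewrite mulrDr mulr1; lra.
have eb : 0 < e <= 2^-1 by rewrite e_gt0 (le_trans e4) // lef_pV2 ?posrE //; lra.
near=> n; have [k [bk lamk]] : exists k : R,
    (forall i : 'I_p, `|(landen_iter x (n + p)).2 0 i - k * 'C(p.-1, i)%:R|
       <= e * numer_size x n) /\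
    `|lam - k| <= 2 * (e * numer_size x n + `|k| * e).
  by near: n; exact: numer_step.
have Nn : (N <= n)%N by near: n; exact: nbhs_infty_ge.
have kb := bound_k e k _ (_ : 0 < e <= 4^-1) (S0 n) lamk.
rewrite e_gt0 e4 in kb; have {}kb := kb isT.
have := bk i; have := SB _ Nn; have := S0 n; rewrite -/C.
move: (numer_size x n) lamk kb => S lamk kb S_ge0 S_leB bki.
rewrite distrC /=; move: bki; set b := (landen_iter x (n + p)).2 0 i => bki.
have -> : b - lam * C = (b - k * C) - (lam - k) * C by ring.
apply: le_trans (ler_normB _ _) _; apply: le_trans eT.
rewrite normrM (ger0_norm C0).
have eSB : e * S <= e * B by rewrite ler_wpM2l // ltW.
have eSB4 : 4 * (e * S) <= B by nra.
have ek : `|k| * e <= e * (2 * `|lam| + B).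
  by rewrite mulrC; apply: ler_wpM2l; [exact: ltW|lra].
have lamk' : `|lam - k| <= 2 * e * (2 * B + 2 * `|lam|).
  by apply: le_trans lamk _; nra.
have := ler_wpM2r C0 lamk'; rewrite /T; lra.
Unshelve. all: by end_near.
Qed.

End NumeratorLimit.

(** * Convergence of the iteration and of the integral *)

Lemma cvg_rV (R : realType) (n : nat) (u : nat -> 'rV[R]_n) (l : 'rV[R]_n) :
  (forall i, u k 0 i @[k --> \oo] --> l 0 i) -> u @ \oo --> l.
Proof.
move=> ul; apply/cvg_ballP => e e0.
have : \forall k \near \oo, forall i : 'I_n, ball (l 0 i) e (u k 0 i).
  by apply: filter_forall => i; move/cvg_ballP: (ul i) => /(_ e e0).
by apply: filterS => k h; split=> // i j; rewrite ord1; exact: h.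
Qed.

Section Convergence.
Variables (R : realType) (p : nat).
Hypothesis hp : (1 <= p)%N.
Implicit Types (x : params R p).

Lemma integral_converges_denp_pos x : integral_converges x <-> denp_pos x.
Proof.
split=> [[/denp_posP]//|xpos]; split; first exact/denp_posP.
exact: partial_integral_cvg.
Qed.

Lemma iteration_cvg x (l : R) : denp_pos x -> partial_integral x @ +oo --> l ->
  iteration_converges_to x (landen_limit p (2 / pi * l)).
Proof.
move=> xpos xl; split=> [n|].
  by apply: denp_pos_defined; exact: denp_pos_iter.
have -> : landen_iter x = fun n => ((landen_iter x n).1, (landen_iter x n).2).
  by apply/funext => n; case: (landen_iter x n).
have l1 : (fun n => (landen_iter x n).1) @ \oo --> (landen_limit p (2 / pi * l)).1.
  apply: cvg_rV => i.
  under [X in X @ _ --> _]funext do rewrite -acoef_in //.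
  by rewrite mxE; exact: acoef_cvg.
have l2 : (fun n => (landen_iter x n).2) @ \oo --> (landen_limit p (2 / pi * l)).2.
  by apply: cvg_rV => i; rewrite mxE; exact: numer_cvg.
exact: (cvg_pair l1 l2).
Qed.

(** If z > 0 is a zero of Q, then z is not 1 as Q(1) is nonzero, and
    mu / (z - 1/z) is a real zero of Q^+. *)
Lemma landen_positive_root x (y : R) : landen_defined x -> 0 < y ->
  (denp x).[y] = 0 -> exists2 y', 0 < y' & (denp (landen x)).[y'] = 0.
Proof.
move=> xdef y0 ry.
have y1 : y != 1.
  by apply/eqP => y1; case: xdef; rewrite /Q1 Qpoly_denp expr1n -y1 ry eqxx.
pose z := Num.sqrt y; have z2 : z ^+ 2 = y by rewrite sqr_sqrtr // ltW.
have z0 : z != 0 by rewrite lt0r_neq0 // sqrtr_gt0.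
have u0 : z - z^-1 != 0.
  by apply: contra y1; rewrite subr_eq0 -z2 expr2 => /eqP zz; rewrite {2}zz mulfV.
exists (Q1root x ^+ 2 / (z - z^-1) ^+ 2).
  by rewrite divr_gt0 // exprn_even_gt0 //= ?Q1root_neq0.
by rewrite denp_landen // ?z2 // ry mul0r mul0r.
Qed.

Lemma denp_root_far x (y : R) : 0 < y -> (denp x).[y] = 0 ->
  exists2 k, (k <= p)%N & 2^-1 < `|acoef x k%:Z - 'C(p, k)%:R|.
Proof.
move=> y0 ry; apply: contrapT => far.
have near_binom k : (k <= p)%N -> `|acoef x k%:Z - 'C(p, k)%:R| <= 2^-1.
  by move=> kp; rewrite leNgt; apply/negP => h; apply: far; exists k.
have h2 : 0 <= 2^-1 :> R by rewrite invr_ge0.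
have := @binomial_estimate R p (fun i => acoef x (p - i)%N%:Z) 1 2^-1 y (ltW y0) h2.
rewrite -denp_sum ry sub0r normrN mul1r.
have w0 : 0 < (1 + y) ^+ p by rewrite exprn_gt0 // addr_gt0.
rewrite (ger0_norm (ltW w0)) => h; have : (1 + y) ^+ p <= 2^-1 * (1 + y) ^+ p.
  by apply: h => i ip; rewrite mul1r -bin_sub //; apply: near_binom; exact: leq_subr.
lra.
Qed.

(** A zero of Q on the positive half-line gives one of every Q_n, but Q_n tends
    to (1 + z^2)^p and is eventually positive there. *)
Lemma iteration_cvg_denp_pos x (l : R) :
  iteration_converges_to x (landen_limit p l) -> denp_pos x.
Proof.
move=> [xdef xl]; apply/denp_posP => z z0; apply/negP => /eqP; rewrite Qpoly_denp => rz.
have z2 : 0 < z ^+ 2.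
  by rewrite lt0r sqr_ge0 andbT; apply: contra_eq_neq rz => ->; rewrite denp0 oner_neq0.
have roots n : exists2 y, 0 < y & (denp (landen_iter x n)).[y] = 0.
  elim: n => [|n [y y0 ry]]; first by exists (z ^+ 2).
  exact: landen_positive_root (xdef n) y0 ry.
have acvg (k : 'I_p.+1) : acoef (landen_iter x n) k%:Z @[n --> \oo] --> ('C(p, k)%:R : R).
  have kp := ltn_ord k; case: (k : nat) kp => [|j] jp.
    by rewrite bin0; under [X in X @ _ --> _]funext do rewrite acoef0; exact: cvg_cst.
  have [jpE|jpN] := eqVneq j.+1 p.
    rewrite jpE binn; under [X in X @ _ --> _]funext do rewrite acoefp.
    exact: cvg_cst.
  have ltjp : (j < p.-1)%N by lia.
  have -> : (fun n => acoef (landen_iter x n) j.+1%:Z) =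
      (fun n => (landen_iter x n).1 0 (Ordinal ltjp)).
    by apply/funext => n; rewrite -acoef_in.
  have l1 : (fun n => (landen_iter x n).1) @ \oo --> (landen_limit p l).1.
    exact: (cvg_comp _ _ xl cvg_fst).
  have -> : 'C(p, j.+1)%:R = (landen_limit p l).1 0 (Ordinal ltjp) by rewrite mxE.
  exact: (@continuous_cvg _ _ _ _ _ _ (fun M : 'rV[R]_p.-1 => M 0 (Ordinal ltjp)) _
    (@coord_continuous R 1 p.-1 0 (Ordinal ltjp) _) l1).
have h2 : 0 < 2^-1 :> R by rewrite invr_gt0.
have [N _ /(_ N (leqnn N)) closeN] : \forall n \near \oo, forall k : 'I_p.+1,
    `|acoef (landen_iter x n) k%:Z - 'C(p, k)%:R| <= 2^-1.
  apply: filter_forall => k; move/cvgrPdist_le: (acvg k) => /(_ _ h2).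
  by apply: filterS => n; rewrite distrC.
have [y y0 ry] := roots N; have [k kp] := denp_root_far y0 ry.
by rewrite ltNge (closeN (Ordinal (kp : (k < p.+1)%N))).
Qed.

End Convergence.

Theorem mainTheorem1 (R : realType) (p : nat) (hp : (1 <= p)%N)
    (x0 : params R p) :
  (integral_converges x0 ->
     iteration_converges_to x0 (landen_limit p (2 / pi * U x0))) /\
  ((exists L : R, iteration_converges_to x0 (landen_limit p L)) <->
     integral_converges x0).
Proof.
have conv : integral_converges x0 ->
    iteration_converges_to x0 (landen_limit p (2 / pi * U x0)).
  move=> [denp_neq0 xcvg]; apply: iteration_cvg => //.
  exact/(integral_converges_denp_pos hp).
split=> //; split=> [[L /(iteration_cvg_denp_pos hp)]|/conv]; last by eexists; eassumption.
by move/(integral_converges_denp_pos hp).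
Qed.
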